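(* (1) Let $C_1:f_1=0$ be a nearly free curve in $\mathbb{P}^2$ and $L$ be a line, not a component of $C_1$, such that $C_1$ and $C_1\cup L$ have only quasihomogeneous singularities. Then $$|C_1\cap L|\ge r_1=mdr(f_1).$$ (2) Let $C_1:f_1=0$ be a nearly free curve in $\mathbb{P}^2$ and $Q$ be a smooth conic, not a component of $C_1$, such that $C_1$ and $C_1\cup Q$ have only quasihomogeneous singularities. Then $$|C_1\cap Q|\ge 2r_1-1,\quad\text{where } r_1=mdr(f_1).$$
   Context: $S=\mathbb{C}[x,y,z]$. For homogeneous $g\in S$ of degree $e$, $AR(g)=\{(a,b,c)\in S^3: ag_x+bg_y+cg_z=0\}$ is the graded $S$-module of Jacobian syzygies (with $AR(g)_s$ the triples with entries in $S_s$), and $mdr(g)=\min\{s\in\mathbb{N}:AR(g)_s\neq0\}$. Let $d_1'\le\dots\le d_m'$ be the degrees of a minimal set of homogeneous generators of $AR(g)$. A reduced curve $C_g:g=0$ is nearly free if $m=3$, $d_1'+d_2'=e$ and $d_3'=d_2'$. A singular point of a reduced plane curve is quasihomogeneous if, in suitable local analytic coordinates, the curve germ is defined by a weighted homogeneous polynomial (with positive weights). $|C_1\cap L|$ and $|C_1\cap Q|$ denote the numbers of points of the set-theoretic intersections. *)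

(* Defs.v *)
From mathcomp Require Import all_boot all_order all_algebra.
From mathcomp Require Import complex.
From mathcomp Require Import boolp classical_sets cardinality reals.
From mathcomp Require Import mpoly.

Set Implicit Arguments.
Unset Strict Implicit.
Unset Printing Implicit Defensive.

Import GRing.Theory.

Local Open Scope ring_scope.
Local Open Scope classical_set_scope.

Section JacobianSyzygies.
Variable C : numClosedFieldType.
Local Notation S := {mpoly C[3]}.

Definition AR (g : S) (v : 'rV[S]_3) : Prop :=
  \sum_(i < 3) v 0 i * g^`M(i) = 0.

Definition AR_deg (g : S) (s : nat) (v : 'rV[S]_3) : Prop :=
  AR g v /\ forall i, v 0 i \is s.-homog.

Definition AR_deg_neq0 (g : S) (s : nat) : Prop :=
  exists2 v, AR_deg g s v & v != 0.

(* The minimum exists for every homogeneous g: see mdrP. *)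
Definition mdr (g : S) : nat :=
  xget 0%N [set s | AR_deg_neq0 g s /\
                    forall t, AR_deg_neq0 g t -> (s <= t)%N].

Definition AR_generated_by (g : S) (m : nat) (J : pred 'I_m)
    (v : 'I_m -> 'rV[S]_3) : Prop :=
  forall w, AR g w -> exists c : 'I_m -> S, w = \sum_(i | J i) c i *: v i.

(* Minimality is with respect to inclusion; by the graded Nakayama lemma m and
   the nondecreasing sequence d depend only on g. *)
Definition AR_min_gens (g : S) (m : nat) (d : m.-tuple nat)
    (v : 'I_m -> 'rV[S]_3) : Prop :=
  [/\ sorted leq d,
      forall i, AR_deg g (tnth d i) (v i),
      AR_generated_by g predT v &
      forall j, ~ AR_generated_by g (predC1 j) v].

Definition reduced_curve (e : nat) (g : S) : Prop :=
  [/\ (0 < e)%N, g \is e.-homog, g != 0 &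
      forall a b : S, g = a ^+ 2 * b -> (msize a <= 1)%N].

Definition nearly_free (g : S) : Prop :=
  exists e d1 d2 d3 (v : 'I_3 -> 'rV[S]_3),
    [/\ reduced_curve e g, AR_min_gens g [tuple d1; d2; d3] v,
        (d1 + d2 = e)%N & d3 = d2].

(* For an irreducible h: the curve h = 0 is a component of g = 0. *)
Definition component (h g : S) : Prop := exists k : S, g = h * k.

End JacobianSyzygies.

Section PlaneCurves.
Variable C : numClosedFieldType.
Local Notation S := {mpoly C[3]}.

(* Points of the projective plane are the lines through 0 in C^3. *)
Definition P2 := {U : {vspace 'rV[C]_3} | \dim U == 1%N}.

Definition vanishes_at (g : S) (p : P2) : Prop :=
  forall v : 'rV[C]_3, v \in val p -> g.@[v 0] = 0.

Definition curve_points (g : S) : set P2 := [set p | vanishes_at g p].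

Definition singular_points (g : S) : set P2 :=
  [set p | vanishes_at g p /\ forall i, vanishes_at g^`M(i) p].

Definition is_line (l : S) : Prop := l \is 1.-homog /\ l != 0.

Definition is_smooth_conic (q : S) : Prop :=
  [/\ q \is 2.-homog, q != 0 & singular_points q = set0].

(* Equation of the curve g = 0 in the affine chart where the i-th homogeneous
   coordinate is 1. *)
Definition dehomog (i : 'I_3) (g : S) : {mpoly C[2]} :=
  g \mPo [tuple if unlift i j is Some k then 'X_k else 1 | j < 3].

End PlaneCurves.

Section AnalyticGerms.
Variable C : numClosedFieldType.

(* Power series in two variables, given by their coefficients; germs of
   analytic functions at the origin of C^2 are the convergent ones. *)
Definition pseries := 'X_{1..2} -> C.

(* A power series converges absolutely near the origin if and only if, for some
   r > 0, its terms are bounded on the polydisc of radius r. *)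
Definition ps_convergent (a : pseries) : Prop :=
  exists2 r : C, 0 < r &
    exists M : C, forall m, `|a m| * r ^+ mdeg m <= M.

Definition ps_one : pseries := fun m => (m == 0%MM)%:R.

(* Cauchy product; same formula as mcoeffM. *)
Definition ps_mul (a b : pseries) : pseries := fun m =>
  \sum_(k : 'X_{1..2 < (mdeg m).+1, (mdeg m).+1} | m == (k.1 + k.2)%MM)
    a k.1 * b k.2.

Definition ps_exp (a : pseries) (n : nat) : pseries := iter n (ps_mul a) ps_one.

Definition ps_comp (g : {mpoly C[2]}) (phi : 'I_2 -> pseries) : pseries :=
  fun m => \sum_(k <- msupp g)
    g@_k * ps_mul (ps_exp (phi ord0) (k ord0)) (ps_exp (phi ord_max) (k ord_max)) m.

(* phi is the inverse of a system of local analytic coordinates centred at a: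
   it maps the origin to a, with invertible Jacobian matrix. *)
Definition analytic_coordinates (a : 'I_2 -> C) (phi : 'I_2 -> pseries) : Prop :=
  [/\ forall i, ps_convergent (phi i),
      forall i, phi i 0%MM = a i &
      \det (\matrix_(i < 2, j < 2) phi i U_(j)%MM) != 0].

Definition weighted_homog (w : 'I_2 -> nat) (d : nat) (h : {mpoly C[2]}) : Prop :=
  forall m, m \in msupp h -> (\sum_(i < 2) w i * m i = d)%N.

(* The germ at a of g = 0 is defined, in the coordinates phi, by a weighted
   homogeneous h: g o phi and h generate the same ideal of convergent series. *)
Definition quasihomog_germ (g : {mpoly C[2]}) (a : 'I_2 -> C) : Prop :=
  exists (phi : 'I_2 -> pseries) (u : pseries)
         (w : 'I_2 -> nat) (d : nat) (h : {mpoly C[2]}),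
    [/\ analytic_coordinates a phi,
        ps_convergent u /\ u 0%MM != 0,
        forall i, (0 < w i)%N,
        weighted_homog w d h &
        forall m, ps_comp g phi m = ps_mul u (fun k => h@_k) m].

(* The germ does not depend, up to analytic isomorphism, on the chart i. *)
Definition quasihomog_at (g : {mpoly C[3]}) (p : P2 C) : Prop :=
  exists (i : 'I_3) (v : 'rV[C]_3),
    [/\ v \in val p, v 0 i = 1 &
        quasihomog_germ (dehomog i g) (fun k => v 0 (lift i k))].

Definition only_quasihomog_sing (g : {mpoly C[3]}) : Prop :=
  forall p, singular_points g p -> quasihomog_at g p.

End AnalyticGerms.

Section MdrExists.
Variable C : numClosedFieldType.
Local Notation S := {mpoly C[3]}.

Lemma mderiv_dhomog (e : nat) (g : S) (i : 'I_3) :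
  g \is e.-homog -> g^`M(i) \is e.-1.-homog.
Proof.
move=> /dhomogP hg; rewrite (mpolyE g) raddf_sum /=.
rewrite big_seq; apply: rpred_sum => m mg; rewrite mderivZ mderivX.
apply: rpredZ; have [->|mi0] := eqVneq (m i) 0%N.
  by rewrite scale0r rpred0.
apply: rpredZ; rewrite dhomogX; apply/eqP.
have le_im : (U_(i) <= m)%MM by rewrite lep1mP.
have <- : mdeg m = e := hg m mg.
by rewrite -[in RHS](submK le_im) mdegD mdeg1 addn1.
Qed.

Lemma mdrP (e : nat) (g : S) : g \is e.-homog ->
  AR_deg_neq0 g (mdr g) /\ forall t, AR_deg_neq0 g t -> (mdr g <= t)%N.
Proof.
move=> hg.
have ex : exists s, `[< AR_deg_neq0 g s >].
  have [g0|g0] := eqVneq g^`M(ord0) 0.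
    exists 0%N; apply/asboolP; exists (\row_j (j == ord0)%:R).
      split; first by rewrite /AR !big_ord_recl big_ord0 !mxE /= g0 !mul0r mulr0 !addr0.
      by move=> i; rewrite mxE; case: (i == _); rewrite ?dhomog1 ?dhomog0.
    apply/eqP => /rowP /(_ ord0); rewrite !mxE eqxx; apply/eqP.
    exact: oner_neq0.
  exists e.-1; apply/asboolP.
  pose v : 'rV[S]_3 := \row_j (if j == ord0 then g^`M(lift ord0 ord0)
    else if j == lift ord0 ord0 then - g^`M(ord0) else 0).
  exists v.
    split.
      by rewrite /AR !big_ord_recl big_ord0 !mxE /= mul0r !addr0 mulNr mulrC subrr.
    move=> i; rewrite mxE; case: ifP => _; first exact: mderiv_dhomog.
    by case: ifP => _; rewrite ?dhomog0 // rpredN mderiv_dhomog.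
  apply/eqP => /rowP /(_ (lift ord0 ord0)); rewrite !mxE /= => /eqP.
  by rewrite oppr_eq0 (negPf g0).
have : [set s | AR_deg_neq0 g s /\
         forall t, AR_deg_neq0 g t -> (s <= t)%N] (mdr g); last by [].
apply: xgetPex; case: (ex_minnP ex) => s /asboolP hs min_s.
by exists s; split => // t ht; apply: min_s; apply/asboolP.
Qed.

End MdrExists.

(* Main.v *)
Require Import Defs.
From HB Require Import structures.
From mathcomp Require Import all_boot all_order all_algebra.
From mathcomp Require Import complex ring zify separable.
From mathcomp Require Import boolp classical_sets cardinality reals.
From mathcomp Require Import mpoly.

(** Let P be a polynomial parametrization of the line (or conic) l = 0, and for a
    syzygy d of the gradient of f1 write G_d = (d . grad l)(P). At a point where
    f1(P) vanishes to order k, the polynomial G_d vanishes to order at least k - 1: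
    by quasihomogeneity there is, to any finite order in formal coordinates, an
    Euler field t tangent to both curves, the field d is tangent to f1 = 0, so
    det(d, t, x) is divisible by f1 because f1 is reduced, whereas t vanishes only
    to first order along l = 0. Hence f1(P) divides G_d times the product R of the
    distinct linear factors of f1(P), and few intersection points force G_d = 0 in
    low degree.

    For a line all generators of AR(f1) would satisfy G_d = 0, which the Koszul
    syzygies contradict. For a conic two of the three generators, u and w (up to
    recombination), satisfy G_u = G_w = 0; then det(u, w, x) = f1 g with g linear
    and g(P) = 0, so g = 0 and u, w are parallel, and the Koszul syzygies show that
    u is divisible by a linear form, against the minimality of its degree. *)

Set Implicit Arguments.
Unset Strict Implicit.
Unset Printing Implicit Defensive.

Import GRing.Theory.

Local Open Scope ring_scope.

(** * Substitution in polynomials and orders of vanishing *)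

Section Substitution.
Variables (n : nat) (K T : comNzRingType) (f : {rmorphism K -> T}).
Implicit Types (x y : 'I_n -> T) (F G : {mpoly K[n]}).

(** The bounds come from a count of degrees. If [f1] does not vanish on all of [l = 0], a point off
    [f1 = 0] is put at the infinity of P, so [f1(P)] has full degree e on a line and 2e on a conic.
    Let s be the degree of the syzygy. Fewer than r1 points on a line give [R] degree at most r1 -
    1, and s + r1 - 1 < d1 + d2 = e. Fewer than 2 r1 - 1 points on a conic give 2(s + 1) + 2 r1 - 2
    <= 2(d1 + d2), with equality only for s = d2; each product of [G_d] and [R] is then a scalar
    multiple of [f1(P)], so the generators are governed by three scalars and two combinations can be
    killed. Quasihomogeneity yields a field tangent to the union only; restricting the Leibniz rule
    to an arc along [l = 0] separates the two curves. Local computations take place modulo a power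
    of the maximal ideal, and each cancellation costs a known number of orders, so the precision is
    fixed after the orders of vanishing and the elimination exponents. Reducedness enters through
    nonzero polynomials in one coordinate lying in the ideal of [f1] and one partial derivative;
    they serve the local and the global division by [f1]. *)

Lemma mpoly_alg_ind (P : {mpoly K[n]} -> Prop) :
  (forall c, P c%:MP) -> (forall i, P 'X_i) ->
  (forall F G, P F -> P G -> P (F + G)) ->
  (forall F G, P F -> P G -> P (F * G)) -> forall F, P F.
Proof.
move=> PC PX PD PM F; rewrite (mpolyE F).
elim: (msupp F) => [|m s IH]; first by rewrite big_nil -mpolyC0.
rewrite big_cons; apply: PD => //; rewrite -mul_mpolyC; apply: (PM) => //.
rewrite mpolyXE_id; apply: (big_ind P) => [||i _]; [by rewrite -mpolyC1 | exact: PM |].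
elim: (m i) => [|k IHk]; first by rewrite expr0 -mpolyC1.
by rewrite exprS; apply: PM.
Qed.

Lemma mmapXU x i : mmap f x 'X_i = x i.
Proof. by rewrite mmapX mmap1U. Qed.

Lemma mpoly_rmorph_eq (g h : {rmorphism {mpoly K[n]} -> T}) :
  (forall c, g c%:MP = h c%:MP) -> (forall i, g 'X_i = h 'X_i) -> g =1 h.
Proof.
move=> eqC eqX; apply: mpoly_alg_ind => // F G eF eG.
  by rewrite !rmorphD eF eG.
by rewrite !rmorphM eF eG.
Qed.

Lemma mmap_chain_rule (d : {additive T -> T}) x F :
  (forall a b, d (a * b) = d a * b + a * d b) -> (forall c, d (f c) = 0) ->
  d (mmap f x F) = \sum_i mmap f x F^`M(i) * d (x i).
Proof.
move=> dM dC; elim/mpoly_alg_ind: F => [c|i|F G eF eG|F G eF eG].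
- by rewrite mmapC dC big1 // => i _; rewrite mderivC mmap0 mul0r.
- rewrite mmapXU (bigD1 i) //= big1 => [|j ji]; rewrite mderivX mnm1E.
    rewrite eqxx scale1r addr0.
    have -> : (U_(i) - U_(i))%MM = 0%MM by apply/mnmP => k; rewrite mnmBE subnn mnm0E.
    by rewrite mpolyX0 rmorph1 mul1r.
  by rewrite eq_sym (negPf ji) scale0r mmap0 mul0r.
- rewrite mmapD raddfD eF eG -big_split; apply: eq_bigr => i _.
  by rewrite raddfD mmapD mulrDl.
- rewrite rmorphM dM eF eG mulr_suml mulr_sumr -big_split.
  apply: eq_bigr => i _; rewrite mderivM mmapD !rmorphM.
  by rewrite mulrDl; congr (_ + _); rewrite ?mulrA // mulrAC.
Qed.

(** [I] plays the role of an ideal, given by closure properties, so that multiples of a fixed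
    polynomial and orders of vanishing are treated alike. *)
Lemma mmap_congr (I : T -> Prop) x y F :
  (forall a b, I a -> I b -> I (a + b)) -> I 0 ->
  (forall a b, I a -> I (a * b)) -> (forall i, I (x i - y i)) ->
  I (mmap f x F - mmap f y F).
Proof.
move=> ID I0 IM Ixy; elim/mpoly_alg_ind: F => [c|i|F G IF IG|F G IF IG].
- by rewrite !mmapC subrr.
- by rewrite !mmapXU.
- by rewrite !mmapD opprD addrACA; apply: ID.
- rewrite !rmorphM /=; set a := mmap f x F; set b := mmap f x G.
  set a' := mmap f y F; set b' := mmap f y G.
  have -> : a * b - a' * b' = (a - a') * b + (b - b') * a' by ring.
  by apply: ID; apply: IM.
Qed.

Lemma mmap_homog_scale d (c : T) x F : F \is d.-homog ->
  mmap f (fun i => c * x i) F = c ^+ d * mmap f x F.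
Proof.
move=> /dhomogP hF; rewrite /mmap mulr_sumr; apply: eq_big_seq => m /hF <-.
rewrite /mmap1 mulrCA; congr (_ * _).
rewrite /= mdegE -prodrXr -big_split; apply: eq_bigr => i _.
by rewrite exprMn.
Qed.

Lemma mmap_map_rmorph (U : comNzRingType) (g : {rmorphism T -> U}) x F :
  g (mmap f x F) = mmap (g \o f) (g \o x) F.
Proof.
rewrite /mmap rmorph_sum; apply: eq_bigr => m _; rewrite rmorphM; congr (_ * _).
by rewrite /mmap1 rmorph_prod; apply: eq_bigr => i _; rewrite rmorphXn.
Qed.

Lemma mmap_eq (x y : 'I_n -> T) F : x =1 y -> mmap f x F = mmap f y F.
Proof. by move=> exy; congr mmap; apply/funext. Qed.

End Substitution.

Lemma euler_mderiv n (K : comNzRingType) d (F : {mpoly K[n]}) : F \is d.-homog ->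
  \sum_i 'X_i * F^`M(i) = d%:R * F.
Proof.
move=> hF; transitivity (\sum_(m <- msupp F) F@_m *: ((mdeg m)%:R *: 'X_[m])).
  rewrite [in LHS](mpolyE F).
  under eq_bigr => i _ do rewrite raddf_sum mulr_sumr.
  rewrite exchange_big; apply: eq_bigr => m _.
  transitivity (\sum_(i < n) F@_m *: ((m i)%:R *: 'X_[m]) : {mpoly K[n]}).
    apply: eq_bigr => i _; rewrite /= mderivZ -scalerAr; congr (_ *: _).
    rewrite mderivX -scalerAr; have [->|mi0] := eqVneq (m i) 0%N; first by rewrite !scale0r.
    congr (_ *: _); rewrite -mpolyXD; congr mpolyX.
    by rewrite addmC submK // lep1mP.
  by rewrite -scaler_sumr -scaler_suml mdegE natr_sum.
rewrite [in RHS](mpolyE F) mulr_sumr; apply: eq_big_seq => m mF; rewrite ((dhomogP _ _ _ hF) m mF).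
by rewrite -[d%:R * _]/(_ * _) -mpolyC_nat mul_mpolyC !scalerA mulrC.
Qed.

Section Order.
Variable R : idomainType.
Implicit Types p q : {poly R}.

(** The zero polynomial has every order; order exactly k is expressed by [ordge k p] together with
    [~ ordge k.+1 p]. *)
Definition ordge N p := forall i, (i < N)%N -> p`_i = 0.

Lemma ordge0 p : ordge 0 p. Proof. by []. Qed.

Lemma ordge_zero N : ordge N 0. Proof. by move=> i _; rewrite coef0. Qed.

Lemma ordgeW N M p : (M <= N)%N -> ordge N p -> ordge M p.
Proof. by move=> MN Np i iM; apply: Np; apply: leq_trans MN. Qed.

Lemma ordgeD N p q : ordge N p -> ordge N q -> ordge N (p + q).
Proof. by move=> Np Nq i iN; rewrite coefD Np ?Nq ?addr0. Qed.

Lemma ordgeN N p : ordge N p -> ordge N (- p).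
Proof. by move=> Np i iN; rewrite coefN Np ?oppr0. Qed.

Lemma ordgeB N p q : ordge N p -> ordge N q -> ordge N (p - q).
Proof. by move=> Np Nq; apply/ordgeD/ordgeN. Qed.

Lemma ordgeM N M p q : ordge N p -> ordge M q -> ordge (N + M) (p * q).
Proof.
move=> Np Mq i iNM; rewrite coefM big1 // => j _.
have [jN|Nj] := ltnP j N; first by rewrite Np ?mul0r.
rewrite Mq ?mulr0 // ltn_subLR; first by apply: leq_trans iNM _; rewrite leq_add2r.
by rewrite -ltnS.
Qed.

Lemma ordgeMl N p q : ordge N q -> ordge N (p * q).
Proof. by move=> Nq; rewrite -[N]add0n; apply: ordgeM. Qed.

Lemma ordgeMr N p q : ordge N p -> ordge N (p * q).
Proof. by rewrite mulrC; apply: ordgeMl. Qed.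

Lemma ordgeX N p : ordge 1 p -> ordge N (p ^+ N).
Proof. by move=> p1; elim: N => // N IH; rewrite exprS -add1n; apply: ordgeM. Qed.

Lemma ordgeXn N : ordge N ('X^N : {poly R}).
Proof. by move=> i iN; rewrite coefXn ltn_eqF. Qed.

Lemma ordge_coef_min N p : ~ ordge N p ->
  exists2 a, (a < N)%N & p`_a != 0 /\ ordge a p.
Proof.
move=> np; have ex : exists a, (a < N)%N && (p`_a != 0).
  apply: contra_notP np => /forallNP H i iN; apply/eqP.
  by have := H i; rewrite iN /= => /negP; rewrite negbK.
case: (ex_minnP ex) => a /andP[aN pa] amin; exists a => //; split=> // i ia.
apply/eqP/negPn/negP => pi; have := amin i; rewrite pi (ltn_trans ia aN) leqNgt ia.
by move/(_ isT).
Qed.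

Lemma ordge_coefM a b p q : ordge a p -> ordge b q ->
  (p * q)`_(a + b) = p`_a * q`_b.
Proof.
move=> pa qb; rewrite coefM (bigD1 (Ordinal (leq_addr b a : (a < (a + b).+1)%N))) //=.
rewrite addKn big1 ?addr0 // => j; rewrite -val_eqE /= => ja.
have [jlt|agt] := ltnP j a; first by rewrite pa ?mul0r.
rewrite qb ?mulr0 // ltn_subLR; last by rewrite -ltnS.
by rewrite ltn_add2r ltn_neqAle eq_sym ja.
Qed.

Lemma ordge_cancel k N p q : ~ ordge k.+1 p -> ordge (N + k) (p * q) -> ordge N q.
Proof.
move=> /ordge_coef_min[a ak [pa pa']] pq.
apply: contrapT => /ordge_coef_min[b bN [qb qb']].
have := pq (a + b)%N; rewrite ordge_coefM // => /(_ _)/eqP.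
rewrite mulf_eq0 (negPf pa) (negPf qb) => H; suff: false by []; apply: H.
by rewrite addnC -addSn leq_add.
Qed.

Lemma ordge_unit_cancel N p q : p`_0 != 0 -> ordge N (p * q) -> ordge N q.
Proof.
by move=> p0 pq; apply: (@ordge_cancel 0 N p); rewrite ?addn0 // => /(_ 0%N isT)/eqP; apply/negP.
Qed.

Lemma ordge_dvd N p : ordge N p -> exists q, p = 'X^N * q.
Proof.
move=> Np; exists (drop_poly N p).
rewrite -[LHS](poly_take_drop N) mulrC [take_poly _ _](_ : _ = 0) ?add0r //.
by apply/polyP => i; rewrite coef_take_poly coef0; case: ltnP => // /Np.
Qed.

End Order.

(** * Arcs in the formal coordinate ring *)

Section LocalOrder.
Variables (n : nat) (K : fieldType).
Local Notation B := {mpoly K[n]}.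
Implicit Types (p q : B).

(** The N-th power of the maximal ideal at the origin: [inN N (p - q)] is equality of power series
    truncated at order N. *)
Definition inN N p := forall m, (mdeg m < N)%N -> p@_m = 0.

(* [X^m |-> X^m t^|m|] turns the order at the origin into a t-adic order. *)
Definition homogenize p : {poly B} :=
  mmap (polyC \o @mpolyC n K) (fun i => 'X_i *: 'X) p.

Lemma mcoeff_pihomog i p m :
  (pihomog mdeg i p)@_m = if mdeg m == i then p@_m else 0.
Proof.
rewrite pihomogE [in LHS]raddf_sum /= big_mkcond /=.
rewrite [in RHS](mpolyE p) [X in if _ then X else _]raddf_sum /=.
case: eqP => mi; last first.
  rewrite big1 // => k _; case: eqP => // ki; rewrite mcoeffZ mcoeffX.
  by case: eqP => [km|]; [case: mi; rewrite -km | rewrite mulr0].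
apply: eq_bigr => k _; case: eqP => // ki; rewrite mcoeffZ mcoeffX.
by case: eqP => [km|]; [case: ki; rewrite km | rewrite mulr0].
Qed.

Lemma coef_homogenize p i : (homogenize p)`_i = pihomog mdeg i p.
Proof.
rewrite pihomogE [in RHS]big_mkcond /homogenize /mmap coef_sum.
apply: eq_bigr => m _; rewrite coefCM.
have -> : mmap1 (fun i : 'I_n => 'X_i *: 'X) m = 'X_[m] *: 'X^(mdeg m) :> {poly B}.
  rewrite mpolyXE_id mdegE /mmap1 -prodrXr -scaler_prod.
  by apply: eq_bigr => j _; rewrite exprZn.
by rewrite coefZ coefXn eq_sym; case: eqP => _; rewrite ?mulr1 ?mulr0 /= ?mul_mpolyC.
Qed.

Lemma inN_homogenize N p : inN N p <-> ordge N (homogenize p).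
Proof.
split=> H.
  move=> i iN; rewrite coef_homogenize; apply/mpolyP => m.
  by rewrite mcoeff_pihomog mcoeff0; case: eqP => // mi; rewrite H ?mi.
move=> m mN; have := H _ mN; rewrite coef_homogenize => /mpolyP/(_ m).
by rewrite mcoeff_pihomog eqxx mcoeff0.
Qed.

Lemma homogenizeM p q : homogenize (p * q) = homogenize p * homogenize q.
Proof. exact: rmorphM. Qed.

Lemma inN0 p : inN 0 p. Proof. by []. Qed.

Lemma inN_zero N : inN N 0. Proof. by move=> m _; rewrite mcoeff0. Qed.

Lemma inNW N M p : (M <= N)%N -> inN N p -> inN M p.
Proof. by move=> MN Np m mM; apply: Np; apply: leq_trans MN. Qed.

Lemma inND N p q : inN N p -> inN N q -> inN N (p + q).
Proof. by move=> Np Nq m mN; rewrite mcoeffD Np ?Nq ?addr0. Qed.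

Lemma inNN N p : inN N p -> inN N (- p).
Proof. by move=> Np m mN; rewrite mcoeffN Np ?oppr0. Qed.

Lemma inNB N p q : inN N p -> inN N q -> inN N (p - q).
Proof. by move=> Np Nq; apply/inND/inNN. Qed.

Lemma inNM N M p q : inN N p -> inN M q -> inN (N + M) (p * q).
Proof.
move=> /inN_homogenize Np /inN_homogenize Mq; apply/inN_homogenize.
by rewrite homogenizeM; apply: ordgeM.
Qed.

Lemma inNMl N p q : inN N q -> inN N (p * q).
Proof. by move=> Nq; rewrite -[N]add0n; apply: inNM. Qed.

Lemma inNMr N p q : inN N p -> inN N (p * q).
Proof. by rewrite mulrC; apply: inNMl. Qed.

Lemma inNX N p : inN 1 p -> inN N (p ^+ N).
Proof. by move=> p1; elim: N => // N IH; rewrite exprS -add1n; apply: inNM. Qed.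

Lemma inN_cancel k N p q : ~ inN k.+1 p -> inN (N + k) (p * q) -> inN N q.
Proof.
move=> np /inN_homogenize; rewrite homogenizeM => pq.
apply/inN_homogenize/(ordge_cancel (k := k) _ pq).
by move=> /inN_homogenize.
Qed.

Lemma inN_deriv N p i : inN N.+1 p -> inN N p^`M(i).
Proof.
by move=> Np m mN; rewrite mcoeff_deriv Np ?mul0rn // mdegD mdeg1 addn1.
Qed.

Lemma mcoeffU_deriv p i : p@_U_(i) = p^`M(i)@_0%MM.
Proof. by rewrite mcoeff_deriv add0m mnm0E mulr1n. Qed.

Lemma inN1E p : p@_0%MM = 0 -> inN 1 p.
Proof. by move=> p0 m; rewrite ltnS leqn0 mdeg_eq0 => /eqP->. Qed.

Lemma mcoeff0M p q : (p * q)@_0%MM = p@_0%MM * q@_0%MM.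
Proof. exact: (rmorphM (mcoeff 0%MM)). Qed.

End LocalOrder.

Section Arcs.
Variables (n : nat) (K : fieldType).
Local Notation B := {mpoly K[n]}.
Implicit Types (F G H : B) (psi : 'I_n -> {poly K}).

Lemma mnm_arc psi m : (forall i, ordge 1 (psi i)) ->
  ordge (mdeg m) (mmap1 psi m) /\
  (mmap1 psi m)`_(mdeg m) = mmap1 (fun i => (psi i)`_1) m.
Proof.
move=> psi1; rewrite /mmap1 mdegE.
apply: (big_ind3 (fun (a : nat) (p : {poly K}) (c : K) => ordge a p /\ p`_a = c)).
- by split=> //; rewrite coefC.
- move=> a p c b q d [pa <-] [qb <-]; split; first exact: ordgeM.
  by rewrite ordge_coefM.
move=> i _; split; first exact: ordgeX.
elim: (m i) => [|k IH]; first by rewrite !expr0 coefC.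
by rewrite exprS -add1n ordge_coefM ?IH ?exprD ?expr1 //; apply: ordgeX.
Qed.

Lemma arc_inN psi N F : (forall i, ordge 1 (psi i)) -> inN N F ->
  ordge N (mmap polyC psi F) /\
  (mmap polyC psi F)`_N = (pihomog mdeg N F).@[fun i => (psi i)`_1].
Proof.
move=> psi1 NF; have degF m : m \in msupp F -> (N <= mdeg m)%N.
  rewrite mcoeff_msupp leqNgt; apply: contraNN => /NF ->; exact/eqP.
split.
  rewrite /mmap big_seq; apply: (big_ind (ordge N)) => [||m /degF mN].
  - exact: ordge_zero.
  - exact: ordgeD.
  by apply/ordgeMl/(ordgeW mN); have [] := mnm_arc m psi1.
rewrite pihomogE raddf_sum /= [in RHS]big_mkcond /mmap coef_sum.
apply: eq_big_seq => m /degF mN; rewrite coefCM.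
have [oc ce] := mnm_arc m psi1; have [eN|ne] := eqVneq (mdeg m) N.
  by rewrite -eN ce mevalZ mevalX.
by rewrite oc ?mulr0 // ltn_neqAle eq_sym ne.
Qed.

Lemma arc_coef0 psi F : (forall i, ordge 1 (psi i)) ->
  (mmap polyC psi F)`_0 = F@_0%MM.
Proof.
move=> psi1; have [_ ->] := arc_inN (N := 0) psi1 (inN0 F).
have -> : pihomog mdeg 0 F = (F@_0%MM)%:MP.
  apply/mpolyP => m; rewrite mcoeff_pihomog mcoeffC mdeg_eq0 eq_sym.
  by case: eqP => [<-|]; rewrite ?mulr1 ?mulr0.
by rewrite mevalC.
Qed.

(** Since [psi] passes through the origin, the differential of [F] may be taken there up to an error
    of order N + 1. This is the linearization behind the Newton iteration of [arc_hensel]. *)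
Lemma arc_shift psi N (a : 'I_n -> K) F : (0 < N)%N -> (forall i, ordge 1 (psi i)) ->
  ordge N.+1 (mmap polyC (fun i => psi i + a i *: 'X^N) F - mmap polyC psi F
     - (\sum_i a i * (F^`M(i))@_0%MM) *: 'X^N).
Proof.
move=> N0 psi1; elim/mpoly_alg_ind: F => [c|i|F G|F G].
- rewrite !mmapC subrr sub0r big1 ?scale0r ?oppr0; first exact: ordge_zero.
  by move=> i _; rewrite mderivC mcoeff0 mulr0.
- rewrite !mmapXU (bigD1 i) //= big1 ?addr0 => [|j ji].
    rewrite -mcoeffU_deriv mcoeffXU eqxx mulr1 addrAC addrK subrr.
    exact: ordge_zero.
  by rewrite -mcoeffU_deriv mcoeffXU eq_sym (negPf ji) mulr0.
- move=> IF IG; have := ordgeD IF IG; congr ordge.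
  rewrite !mmapD.
  have -> : \sum_i a i * ((F + G)^`M(i))@_0%MM =
     \sum_i a i * (F^`M(i))@_0%MM + \sum_i a i * (G^`M(i))@_0%MM.
    by rewrite -big_split; apply: eq_bigr => i _; rewrite mderivD mcoeffD mulrDr.
  by rewrite scalerDl; ring.
move=> IF IG; rewrite !rmorphM /=.
have -> : \sum_i a i * ((F * G)^`M(i))@_0%MM =
   (\sum_i a i * (F^`M(i))@_0%MM) * G@_0%MM + F@_0%MM * \sum_i a i * (G^`M(i))@_0%MM.
  rewrite mulr_suml mulr_sumr -big_split; apply: eq_bigr => i _.
  by rewrite mderivM mcoeffD !mcoeff0M /=; ring.
rewrite -(arc_coef0 F psi1) -(arc_coef0 G psi1).
set f := mmap polyC psi F in IF *; set g := mmap polyC psi G in IG *.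
set f' := mmap polyC _ F in IF *; set g' := mmap polyC _ G in IG *.
set c := \sum_i _ in IF *; set d := \sum_i _ in IG *.
rewrite -!mul_polyC in IF IG *; rewrite polyCD !polyCM.
have fE : ordge 1 (f - (f`_0)%:P) by case=> // _; rewrite coefB coefC subrr.
have gE : ordge 1 (g - (g`_0)%:P) by case=> // _; rewrite coefB coefC subrr.
have NX := @ordgeXn K N.
have -> : f' * g' - f * g - (c%:P * (g`_0)%:P + (f`_0)%:P * d%:P) * 'X^N =
  (f' - f - c%:P * 'X^N) * g' + (g' - g - d%:P * 'X^N) * (f + c%:P * 'X^N)
  - (g' - g - d%:P * 'X^N) * (c%:P * 'X^N)
  + c%:P * ((g - (g`_0)%:P) * 'X^N)
  + c%:P * (g' - g) * 'X^N + d%:P * ((f - (f`_0)%:P) * 'X^N).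
  by ring.
have X1 (p : {poly K}) : ordge 1 p -> ordge N.+1 (p * 'X^N).
  by move=> p1; rewrite -add1n; exact: (ordgeM p1 NX).
apply: ordgeD; last by apply: ordgeMl; apply: X1.
apply: ordgeD; last first.
  apply: X1; apply: ordgeMl; have -> : g' - g = (g' - g - d%:P * 'X^N) + d%:P * 'X^N by ring.
  apply: ordgeD; first exact: ordgeW IG.
  by apply/ordgeMl/(ordgeW N0).
apply: ordgeD; last by apply: ordgeMl; apply: X1.
by apply: ordgeB; [apply: ordgeD|]; apply: ordgeMr.
Qed.

(** Newton iteration: correcting [psi] and [w] by multiples of ['X^(N.+1)] changes the next
    coefficient of the error by a combination of the partial derivatives of [Phi] and of [Phi]
    itself at the origin. These span all of space, so every error can be cancelled. The factor [w]
    absorbs the rescaling of homogeneous coordinates. *)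
Lemma arc_hensel (Phi : 'I_3 -> B) (Q : 'I_3 -> {poly K}) (c : K) N : c != 0 ->
  (forall i, (Q i)`_0 = c * (Phi i)@_0%MM) ->
  (forall e : 'I_3 -> K, exists (a : 'I_n -> K) (b : K), forall i,
     e i = \sum_j a j * ((Phi i)^`M(j))@_0%MM + b * (Phi i)@_0%MM) ->
  exists psi w, (forall j, ordge 1 (psi j)) /\
    forall i, ordge N.+1 (mmap polyC psi (Phi i) - w * Q i).
Proof.
move=> c0 Q0 span; elim: N => [|N [psi [w [psi1 IH]]]].
  exists (fun=> 0), (c^-1)%:P; split=> [j|i]; first exact: ordge_zero.
  case=> // _; rewrite coefB arc_coef0; last by move=> j; apply: ordge_zero.
  by rewrite coefCM Q0 mulKf ?subrr.
have [a [b eab]] := span (fun i => - (mmap polyC psi (Phi i) - w * Q i)`_N.+1).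
exists (fun j => psi j + a j *: 'X^(N.+1)), (w - (b / c) *: 'X^(N.+1)); split=> [j|i].
  apply: ordgeD => //; rewrite -mul_polyC; apply: ordgeMl.
  by apply: (@ordgeW _ N.+1) => //; apply: ordgeXn.
have := arc_shift (N := N.+1) a (Phi i) isT psi1.
set s := \sum_j _; have es : s = - (mmap polyC psi (Phi i) - w * Q i)`_N.+1 - b * (Phi i)@_0%MM.
  by rewrite eab addrK.
move: (IH i) es; set f := mmap polyC psi _; set f' := mmap polyC _ (Phi i).
move=> hf es H.
have -> : f' - (w - (b / c) *: 'X^(N.+1)) * Q i =
  (f' - f - s *: 'X^(N.+1)) + ((f - w * Q i) + (s + b / c * (Q i)`_0) *: 'X^(N.+1))
  + ((b / c) *: 'X^(N.+1)) * (Q i - ((Q i)`_0)%:P).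
  rewrite -!mul_polyC polyCD !polyCM; ring.
apply: ordgeD; first apply: ordgeD => //.
  move=> k; rewrite ltnS leq_eqVlt => /predU1P[->|kN].
    rewrite coefD coefZ coefXn eqxx mulr1 es Q0 mulrA divfK //; ring.
  by rewrite coefD hf // coefZ coefXn ltn_eqF // mulr0 addr0.
rewrite -scalerAl -mul_polyC; apply: ordgeMl; rewrite -addn1; apply: ordgeM; first exact: ordgeXn.
by case=> // _; rewrite coefB coefC subrr.
Qed.

End Arcs.

Lemma dhomog1_sum n (R : nzRingType) (l : {mpoly R[n]}) : l \is 1.-homog ->
  l = \sum_i l@_U_(i) *: 'X_i.
Proof.
move=> hl; apply/mpolyP => m; rewrite raddf_sum /=.
have [/mdeg1P[i /eqP ->]|m1] := boolP (mdeg m == 1%N).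
  rewrite (bigD1 i) //= mcoeffZ mcoeffXU eqxx mulr1 big1 ?addr0 // => j ji.
  by rewrite mcoeffZ mcoeffXU (negPf ji) mulr0.
rewrite (dhomog_nemf_coeff hl m1) big1 // => i _; rewrite mcoeffZ mcoeffX.
by case: eqP => [e|_]; [rewrite -e mdeg1 in m1 | rewrite mulr0].
Qed.

Lemma mmap_idX n (R : comNzRingType) (F : {mpoly R[n]}) :
  mmap (@mpolyC n R) (fun i => 'X_i) F = F.
Proof.
apply: (mpoly_rmorph_eq (g := mmap (@mpolyC n R) (fun i => 'X_i)) (h := idfun)).
  by move=> c /=; rewrite mmapC.
by move=> i /=; rewrite mmapXU.
Qed.

(** * Division by the equation of a smooth branch along an arc *)

Section Division.
Variable K : fieldType.
Local Notation B := {mpoly K[2]}.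
Implicit Types (F G H ell : B) (psi : 'I_2 -> {poly K}).

Lemma mmap_proportional (c : 'I_2 -> K) (t : B) F d : F \is d.-homog ->
  mmap (@mpolyC 2 K) (fun i => c i *: t) F = F.@[c] *: t ^+ d.
Proof.
move=> hF; rewrite (mmap_eq _ (y := fun i => t * (c i)%:MP)); last first.
  by move=> i; rewrite -mul_mpolyC mulrC.
rewrite (mmap_homog_scale _ _ _ hF) mulrC -mul_mpolyC; congr (_ * _).
by rewrite /meval mmap_map_rmorph.
Qed.

Lemma mmap_scaleX (a : K) F d : F \is d.-homog ->
  mmap (@mpolyC 2 K) (fun i => a *: 'X_i) F = a ^+ d *: F.
Proof.
move=> hF; rewrite (mmap_eq _ (y := fun i => a%:MP * 'X_i)); last first.
  by move=> i; rewrite mul_mpolyC.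
rewrite (mmap_homog_scale _ _ _ hF) -rmorphXn /= mul_mpolyC; congr (_ *: _).
exact: mmap_idX.
Qed.

Lemma ord2_eq (a b k : 'I_2) : a != b -> k != a -> k = b.
Proof.
by case: a b k => [[|[|a]] ia] [[|[|b]] ib] [[|[|k]] ik] // _ _; apply: val_inj.
Qed.

(** Modulo [ell] the vectors [p a *: 'X_i] and [p i *: 'X_a] agree, so [p a ^+ j *: H] is congruent
    to [H.@[p] *: 'X_a ^+ j], which is zero; and [p a] is invertible. *)
Lemma linear_dvd_binary (p : 'I_2 -> K) H ell j :
  H \is j.-homog -> H.@[p] = 0 -> ell \is 1.-homog -> ell != 0 -> ell.@[p] = 0 ->
  (exists i, p i != 0) -> exists q, H = q * ell.
Proof.
move=> hH Hp hell ell0 ellp [i0 pi0].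
have ellE := dhomog1_sum hell.
have [b cb] : exists b, ell@_U_(b) != 0.
  apply: contrapT => /forallNP c0; case/negP: ell0; rewrite ellE big1 // => i _.
  by have /negP := c0 i; rewrite negbK => /eqP ->; rewrite scale0r.
have [a ab] : exists a : 'I_2, a != b.
  by case: (unliftP ord0 b) => [k|] ->; [exists ord0 | exists (lift ord0 ord0)].
have two (V : zmodType) (h : 'I_2 -> V) : \sum_i h i = h a + h b.
  rewrite (bigD1 a) //= (bigD1 b) 1?eq_sym //= big1 ?addr0 // => k /andP[ka kb].
  by rewrite (ord2_eq ab ka) eqxx in kb.
rewrite two in ellE.
have ellp' : ell@_U_(a) * p a + ell@_U_(b) * p b = 0.
  by rewrite -[RHS]ellp [in RHS]ellE mevalD !mevalZ !mevalXU.
have pa : p a != 0.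
  apply: contraNneq pi0 => pa; move: ellp'; rewrite pa mulr0 add0r => /eqP.
  rewrite mulf_eq0 (negPf cb) /= => pb.
  by have [->|ia] := eqVneq i0 a; [rewrite pa | rewrite (ord2_eq ab ia)].
pose I (t : B) := exists q, t = q * ell.
have : I (mmap (@mpolyC 2 K) (fun i => p a *: 'X_i) H -
          mmap (@mpolyC 2 K) (fun i => p i *: 'X_a) H).
  apply: mmap_congr => [x y [q ->] [r ->]||x y [q ->]|i].
  - by exists (q + r); rewrite mulrDl.
  - by exists 0; rewrite mul0r.
  - by exists (q * y); rewrite mulrAC.
  have [->|ia] := eqVneq i a; first by exists 0; rewrite subrr mul0r.
  rewrite (ord2_eq ab ia); exists (p a / ell@_U_(b))%:MP.
  rewrite mul_mpolyC {2}ellE scalerDr !scalerA divfK // addrC; congr (_ + _).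
  have -> : p b = - (ell@_U_(a) * p a / ell@_U_(b)).
    apply: (mulIf cb); rewrite mulNr divfK //; apply/eqP.
    by rewrite -addr_eq0 -ellp'; apply/eqP; ring.
  by rewrite scaleNr opprK; congr (_ *: _); ring.
rewrite (mmap_proportional _ _ hH) Hp scale0r subr0 (mmap_scaleX _ hH) => -[q Hq].
exists ((p a ^+ j)^-1 *: q); rewrite -scalerAl -Hq scalerA mulVf ?scale1r //.
exact: expf_neq0.
Qed.

(** The initial form of the remainder vanishes at the tangent vector of the arc, which is also the
    zero of the linear part of [ell]. In two variables it is therefore a multiple of that linear
    part, and the quotient improves [g] by one order. *)
Lemma arc_division psi ell G N j : (forall i, ordge 1 (psi i)) ->
  (exists i, (psi i)`_1 != 0) -> ell@_0%MM = 0 -> (exists i, ell@_U_(i) != 0) ->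
  ordge N (mmap polyC psi ell) -> (j <= N)%N -> ordge j (mmap polyC psi G) ->
  exists g, inN j (G - g * ell).
Proof.
move=> psi1 psi1' ell0 ell1 ellN jN.
have {ell0} ell0 := inN1E ell0.
elim: j jN => [|j IH] jN Gj; first by exists 0.
have [g Hg] := IH (ltnW jN) (ordgeW (leqnSn _) Gj).
(* Order one is separate: the general step needs [ell] to vanish to order at least 2 along the
   arc. *)
case: j jN Gj IH Hg => [|j] jN Gj _ Hg.
  by exists 0; rewrite mul0r subr0; apply: inN1E; rewrite -(arc_coef0 _ psi1) Gj.
set H := G - _ in Hg.
have Hj : ordge j.+2 (mmap polyC psi H).
  rewrite mmapB; apply: ordgeB => //; rewrite rmorphM; apply: ordgeMl.
  exact: ordgeW ellN.
have [_ Hc] := arc_inN psi1 Hg; rewrite Hj // in Hc.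
have [_ ellc] := arc_inN psi1 ell0; rewrite (ellN 1%N) ?(leq_trans _ jN) // in ellc.
have e1 : pihomog mdeg 1 ell != 0.
  have [i ci] := ell1; apply: contra_neqN ci => /eqP e.
  by have := mcoeff_pihomog 1 ell U_(i); rewrite e mdeg1 eqxx mcoeff0.
have [q Hq] := linear_dvd_binary (pihomogP _ _ _) (esym Hc) (pihomogP _ _ _) e1 (esym ellc) psi1'.
have ell12 : inN 2 (ell - pihomog mdeg 1 ell).
  move=> m m2; rewrite mcoeffB mcoeff_pihomog; case: eqP => [|m1]; first by rewrite subrr.
  by rewrite subr0 ell0 //; case: (mdeg m) m1 m2 => [|[]].
have qj : inN j q.
  apply: (@inN_cancel _ _ 1 _ (pihomog mdeg 1 ell)).
    move=> /(_ _ _) H2; case/negP: e1; apply/eqP/mpolyP => m; rewrite mcoeff0.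
    have [m1|m1] := eqVneq (mdeg m) 1%N; first by rewrite H2 ?m1.
    by rewrite mcoeff_pihomog (negPf m1).
  rewrite mulrC -Hq addn1 => m mj; rewrite mcoeff_pihomog ltn_eqF //.
exists (g + q).
have -> : G - (g + q) * ell =
   (H - pihomog mdeg j.+1 H) - q * (ell - pihomog mdeg 1 ell).
  by rewrite Hq /H; ring.
apply: inNB; last by rewrite -(addn2 j); apply: inNM.
move=> m; rewrite ltnS leq_eqVlt mcoeffB mcoeff_pihomog => /predU1P[->|mj].
  by rewrite eqxx subrr.
by rewrite Hg // ltn_eqF // subr0.
Qed.

(** On the arc [X] vanishes and [Y] is a parameter, so [p] vanishes there to order M - n and is a
    multiple of [X] to that order; one factor [X] is cancelled and the argument repeated.
    Multiplying back by [Y ^+ n] recovers the n lost orders, so the loss n occurs once and each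
    factor [X] costs one more. *)
Lemma arc_regular psi (X Y p q : B) (N n j M : nat) :
  (forall i, ordge 1 (psi i)) -> (exists i, (psi i)`_1 != 0) ->
  X@_0%MM = 0 -> (exists i, X@_U_(i) != 0) -> Y@_0%MM = 0 ->
  ordge N (mmap polyC psi X) -> ordge 2 (mmap polyC psi Y - 'X) ->
  (M <= N)%N -> inN M (p * Y ^+ n - q * X ^+ j) ->
  exists g, inN (M - n - j) (p - g * X ^+ j).
Proof.
move=> psi1 psi1' X0 X1 Y0 XN Y1 MN.
have Yn : ~ ordge n.+1 (mmap polyC psi (Y ^+ n)).
  move=> /(_ n (leqnn _)); rewrite rmorphXn.
  have e : (mmap polyC psi Y)`_1 = 1.
    by have := Y1 1%N isT; rewrite coefB coefX => /eqP; rewrite subr_eq0 => /eqP.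
  have o : ordge 1 (mmap polyC psi Y) by case=> // _; rewrite arc_coef0.
  suff -> : (mmap polyC psi Y ^+ n)`_n = 1 by apply/eqP/oner_neq0.
  elim: n => [|k IH]; first by rewrite expr0 coefC.
  by rewrite exprS -(add1n k) ordge_coefM // ?IH ?e ?mul1r //; apply: ordgeX.
have Xnot2 : ~ inN 2 X.
  by move=> X2; have [i /eqP] := X1; apply; apply: X2; rewrite mdeg1.
elim: j M MN p q => [|j IH] M MN p q Hpq.
  by exists p; rewrite expr0 mulr1 subrr; apply: inN_zero.
have pM : ordge (M - n) (mmap polyC psi p).
  have [nM|Mn] := leqP n M; last by rewrite (eqP (ltnW Mn : (M - n)%N == 0%N)).
  apply: (ordge_cancel Yn); rewrite subnK // mulrC -rmorphM.
  rewrite (_ : p * _ = (p * Y ^+ n - q * X ^+ j.+1) + q * X ^+ j.+1); last by ring.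
  rewrite /= mmapD; apply: ordgeD; first by have [] := arc_inN psi1 Hpq.
  rewrite rmorphM exprS rmorphM; apply/ordgeMl/ordgeMr.
  exact: ordgeW XN.
have MnN : (M - n <= N)%N by apply: leq_trans MN; apply: leq_subr.
have [p1 Hp1] := arc_division psi1 psi1' X0 X1 XN MnN pM.
have [nM|Mn] := leqP n M; last by exists 0; rewrite (eqP (ltnW Mn : (M - n)%N == 0%N)) sub0n.
have H1 : inN (M - 1) (p1 * Y ^+ n - q * X ^+ j).
  have [M0|M0] := posnP M; first by rewrite M0.
  apply: (inN_cancel (p := X) Xnot2); rewrite subnK //.
  rewrite exprS in Hpq.
  have -> : X * (p1 * Y ^+ n - q * X ^+ j) =
     (p * Y ^+ n - q * (X * X ^+ j)) - (p - p1 * X) * Y ^+ n by ring.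
  apply: inNB => //; rewrite -(subnK nM); apply: inNM => //.
  by apply: inNX; apply: inN1E.
have [|g Hg] := IH (M - 1)%N _ p1 q H1; first by apply: leq_trans MN; apply: leq_subr.
exists g; rewrite exprS.
have -> : p - g * (X * X ^+ j) = (p - p1 * X) + (p1 - g * X ^+ j) * X by ring.
apply: inND; first by apply: inNW Hp1; apply: leq_subr.
by apply: inNW (inNMr _ Hg); lia.
Qed.

End Division.

(** * Weighted homogeneous germs *)

Import Num.Theory Order.TTheory.

Section Truncation.
Variable C : numClosedFieldType.
Local Notation B := {mpoly C[2]}.

Definition truncates N (p : B) (a : pseries C) := forall m, (mdeg m < N)%N -> p@_m = a m.

Lemma truncatesM N p q a b : truncates N p a -> truncates N q b ->
  truncates N (p * q) (ps_mul a b).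
Proof.
move=> pa qb m mN; rewrite mcoeffM /ps_mul; apply: eq_bigr => k /eqP mk.
have kN : (mdeg k.1 + mdeg k.2 < N)%N by rewrite -mdegD -mk.
by rewrite pa ?qb //; apply: leq_ltn_trans kN; rewrite ?leq_addl ?leq_addr.
Qed.

Lemma truncates_exp N p a k : truncates N p a -> truncates N (p ^+ k) (ps_exp a k).
Proof.
move=> pa; elim: k => [|k IH]; last by rewrite exprS; apply: truncatesM.
by move=> m mN; rewrite expr0 mcoeff1.
Qed.

Lemma truncates_comp N (g : B) (Phi : 'I_2 -> B) phi :
  (forall i, truncates N (Phi i) (phi i)) ->
  truncates N (mmap (@mpolyC 2 C) Phi g) (ps_comp g phi).
Proof.
move=> Pphi m mN; rewrite /mmap raddf_sum /=; apply: eq_bigr => k _.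
rewrite mul_mpolyC mcoeffZ; congr (_ * _).
rewrite /mmap1 big_ord_recl big_ord1 (_ : lift _ _ = ord_max); last exact: val_inj.
by apply: (truncatesM _ _ mN); apply: truncates_exp.
Qed.

Lemma quasihomog_germ_trunc (g : B) a : quasihomog_germ g a ->
  forall N, (1 < N)%N -> exists (Phi : 'I_2 -> B) (u : B) w d (h : B),
    [/\ forall i, (Phi i)@_0%MM = a i,
        \det (\matrix_(i < 2, j < 2) (Phi i)@_U_(j)) != 0,
        u@_0%MM != 0,
        (forall i, (0 < w i)%N) /\ weighted_homog w d h &
        inN N (mmap (@mpolyC 2 C) Phi g - u * h)].
Proof.
case=> phi [u [w [d [h [[_ phi0 det] [_ u0] w0 hh eq]]]]] N N1.
pose tr (a : pseries C) : B := \sum_(m : 'X_{1..2 < N}) a m *: 'X_[m].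
have trE a' : truncates N (tr a') a' by move=> m mN; rewrite /tr mcoeff_mpoly.
exists (fun i => tr (phi i)), (tr u), w, d, h; split=> //.
- by move=> i; rewrite trE ?mdeg0 ?(ltnW N1).
- have <- : \matrix_(i, j) phi i U_(j)%MM = \matrix_(i, j) (tr (phi i))@_U_(j) => //.
  by apply/matrixP => i j; rewrite !mxE trE // mdeg1.
- by rewrite trE ?mdeg0 ?(ltnW N1).
move=> m mN; rewrite mcoeffB (truncates_comp _ (fun i => trE (phi i))) // eq.
apply/eqP; rewrite subr_eq0; apply/eqP; symmetry.
by apply: (truncatesM (N := N)).
Qed.

End Truncation.

Section EulerField.
Variable K : fieldType.
Local Notation B := {mpoly K[2]}.

(** The weighted Euler vector field; weighted homogeneous polynomials are its eigenvectors, the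
    eigenvalue being the weighted degree. *)
Definition wfield (w : 'I_2 -> nat) (p : B) : B :=
  \sum_i (w i)%:R *: ('X_i * p^`M(i)).

Lemma wfield_is_additive w : additive (wfield w).
Proof.
move=> p q; rewrite /wfield -sumrB; apply: eq_bigr => i _.
by rewrite mderivB mulrBr scalerBr.
Qed.

HB.instance Definition _ w := GRing.isAdditive.Build B B (wfield w) (wfield_is_additive w).

Lemma wfieldM w p q : wfield w (p * q) = wfield w p * q + p * wfield w q.
Proof.
rewrite /wfield mulr_suml mulr_sumr -big_split; apply: eq_bigr => i _.
rewrite mderivM -!mul_mpolyC; set c := (_)%:MP_[_].
by rewrite !mulrDr !mulrA; congr (_ + _); rewrite [p * c]mulrC -!mulrA; congr (_ * _); rewrite mulrCA.
Qed.

Lemma wfieldC w c : wfield w c%:MP = 0.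
Proof. by rewrite /wfield big1 // => i _; rewrite mderivC mulr0 scaler0. Qed.

Lemma wfield_inN w N p : inN N p -> inN N (wfield w p).
Proof.
move=> pN; apply: (big_ind (inN N)) => [||i _]; [exact: inN_zero | exact: inND |].
rewrite -mul_mpolyC; apply: inNMl; case: N pN => // N pN; rewrite -(add1n N); apply: inNM.
  by apply: inN1E; rewrite mcoeffX mnm1_eq0.
exact: inN_deriv.
Qed.

Lemma wfield_weighted w d (h : {mpoly K[2]}) :
  (forall m, m \in msupp h -> (\sum_(i < 2) w i * m i = d)%N) ->
  wfield w h = d%:R *: h.
Proof.
move=> hh; rewrite [in RHS](mpolyE h) scaler_sumr /wfield.
transitivity (\sum_(i < 2) \sum_(m <- msupp h) ((w i)%:R * (m i)%:R * h@_m) *: 'X_[m] : B).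
  apply: eq_bigr => i _; rewrite {1}(mpolyE h) raddf_sum /= mulr_sumr scaler_sumr.
  apply: eq_bigr => m _; rewrite mderivZ mderivX -!scalerAr !scalerA.
  have [->|mi] := eqVneq (m i) 0%N; first by rewrite !mulr0 mul0r !scale0r.
  rewrite -mpolyXD addmC submK ?lep1mP //; congr (_ *: _); ring.
rewrite exchange_big; apply: eq_big_seq => m /hh <-.
by rewrite scalerA -scaler_suml natr_sum mulr_suml; under eq_bigr do rewrite -natrM.
Qed.

End EulerField.

(** * Vector products and Cramer's rule in three dimensions *)

Section Cross.
Variable R : comNzRingType.
Implicit Types a b c G : 'I_3 -> R.

Definition dot3 a b := \sum_j a j * b j.

Definition cross3 a b (j : 'I_3) : R :=
  a (ordS j) * b (ord_pred j) - a (ord_pred j) * b (ordS j).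

Definition det3 a b c := dot3 a (cross3 b c).

Lemma ordS3 : (ordS (0 : 'I_3) = 1 :> 'I_3) * (ordS (1 : 'I_3) = 2%:R :> 'I_3) *
  (ordS (2%:R : 'I_3) = 0 :> 'I_3) * (ord_pred (0 : 'I_3) = 2%:R :> 'I_3) *
  (ord_pred (1 : 'I_3) = 0 :> 'I_3) * (ord_pred (2%:R : 'I_3) = 1 :> 'I_3).
Proof. by do !split; apply: val_inj. Qed.

Lemma ord3_ind (P : 'I_3 -> Prop) : P 0 -> P 1 -> P 2%:R -> forall j, P j.
Proof.
move=> P0 P1 P2 [[|[|[|j]]] hj] //.
- by rewrite (_ : Ordinal hj = 0) //; apply: val_inj.
- by rewrite (_ : Ordinal hj = 1) //; apply: val_inj.
- by rewrite (_ : Ordinal hj = 2%:R) //; apply: val_inj.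
Qed.

Lemma sum3 (V : zmodType) (h : 'I_3 -> V) : \sum_j h j = h 0 + h 1 + h 2%:R.
Proof.
rewrite !big_ord_recl big_ord0 addr0 addrA.
by congr (h _ + h _ + h _); apply: val_inj.
Qed.

(** With [G] a gradient and the position vector among [a], [b], [c], this turns knowledge of the
    derivatives along three fields into divisibility or vanishing of their determinant times that
    gradient. *)
Lemma cramer3 a b c G j : det3 a b c * G j =
  dot3 G a * cross3 b c j + dot3 G b * cross3 c a j + dot3 G c * cross3 a b j.
Proof.
rewrite /det3 /dot3 !sum3 /cross3 !ordS3.
by elim/ord3_ind: j; rewrite !ordS3; ring.
Qed.

End Cross.

(** * Local parametrizations of the plane and lifting of arcs *)

Section Frame.
Variable K : fieldType.
Local Notation B := {mpoly K[2]}.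
Variables (Phi : 'I_3 -> B) (v : 'I_3 -> K) (i : 'I_3).

Definition is_frame := [/\ Phi i = 1,
  forall j, (Phi j)@_0%MM = v j &
  \det (\matrix_(k < 2, j < 2) (Phi (lift i k))@_U_(j)) != 0].

Variable fr : is_frame.

Lemma frame_v : v i = 1.
Proof. by case: fr => Pi /(_ i) <- _; rewrite Pi mcoeff1 eqxx. Qed.

Lemma frame_deriv_i k : ((Phi i)^`M(k))@_0%MM = 0.
Proof. by case: fr => -> _ _; rewrite -mpolyC1 mderivC mcoeff0. Qed.

(** The partial derivatives of [Phi] span the vectors with i-th coordinate zero, and [v], with i-th
    coordinate 1, supplies the missing direction. *)
Lemma frame_span (e : 'I_3 -> K) : exists (a : 'I_2 -> K) (b : K), forall j,
  e j = \sum_k a k * ((Phi j)^`M(k))@_0%MM + b * (Phi j)@_0%MM.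
Proof.
case: fr => Pi P0; set J := \matrix_(_, _) _ => detJ.
pose x := invmx J *m \col_k (e (lift i k) - e i * v (lift i k)).
exists (fun k => x k 0), (e i) => j; rewrite P0.
case: (unliftP i j) => [k|] ->; last first.
  by rewrite frame_v mulr1 big1 ?add0r // => k _; rewrite frame_deriv_i mulr0.
have : (J *m x) k 0 = e (lift i k) - e i * v (lift i k).
  by rewrite mulKVmx ?mxE // unitmxE unitfE.
rewrite mxE => /eqP; rewrite eq_sym subr_eq => /eqP ->; congr (_ + _); apply: eq_bigr => k' _.
by rewrite mxE mcoeffU_deriv mulrC.
Qed.

Lemma frame_indep (a : 'I_2 -> K) :
  (forall j, \sum_k a k * ((Phi j)^`M(k))@_0%MM = 0) -> forall k, a k = 0.
Proof.
case: fr => _ _; set J := \matrix_(_, _) _ => detJ a0 k.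
have Ju : J \in unitmx by rewrite unitmxE unitfE.
have Ja : J *m (\col_k a k) = 0.
  apply/colP => k'; rewrite !mxE -[RHS](a0 (lift i k')); apply: eq_bigr => k'' _.
  by rewrite !mxE mcoeffU_deriv mulrC.
have := congr1 (fun M => (invmx J *m M) k 0) Ja.
by rewrite mulKmx // mulmx0 !mxE.
Qed.

Lemma arc_coef1 (psi : 'I_2 -> {poly K}) F : (forall k, ordge 1 (psi k)) ->
  (mmap polyC psi F)`_1 = \sum_k (psi k)`_1 * (F^`M(k))@_0%MM.
Proof.
move=> psi1; have := mmap_chain_rule (f := polyC) (d := deriv) psi F (@derivM K) (@derivC K).
move/(congr1 (fun p : {poly K} => p`_0)); rewrite coef_deriv mulr1n => ->.
rewrite coef_sum; apply: eq_bigr => k _.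
by rewrite coef0M arc_coef0 // coef_deriv mulr1n mulrC.
Qed.

(** If the lifted arc had no linear term, the linear coefficient of [w * Q] would vanish, and the
    derivative of [Q] at 0 would be proportional to [v]. *)
Lemma frame_arc (Q : 'I_3 -> {poly K}) (c : K) N : c != 0 -> (0 < N)%N ->
  (forall j, (Q j)`_0 = c * v j) -> (~ exists x, forall j, (Q j)`_1 = x * v j) ->
  exists psi (w : {poly K}), [/\ forall k, ordge 1 (psi k), exists k, (psi k)`_1 != 0,
    w`_0 != 0 & forall j, ordge N.+1 (mmap polyC psi (Phi j) - w * Q j)].
Proof.
move=> c0 N0 Q0 Q1; have [Pi P0 _] := fr.
have Q0' j : (Q j)`_0 = c * (Phi j)@_0%MM by rewrite P0.
have [psi [w [psi1 H]]] := arc_hensel N c0 Q0' frame_span.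
have w0 : w`_0 != 0.
  have := H i 0%N isT; rewrite coefB arc_coef0 // P0 frame_v coef0M Q0 frame_v mulr1.
  by apply: contra_eq_neq => ->; rewrite mul0r subr0 oner_eq0.
exists psi, w; split=> //; apply: contrapT => /forallNP psi0; apply: Q1.
exists (- (w`_1 * c / w`_0)) => j.
have := H j 1%N; rewrite ltnS N0 => /(_ isT); rewrite coefB arc_coef1 // big1 => [|k _]; last first.
  by have /negP := psi0 k; rewrite negbK => /eqP ->; rewrite mul0r.
rewrite sub0r => /eqP; rewrite oppr_eq0 coefM !big_ord_recl big_ord0 addr0 /= Q0 => /eqP e.
apply: (mulfI w0); move/eqP: e; rewrite addr_eq0 => /eqP ->.
by field.
Qed.

Lemma mmap_arc (Q : 'I_3 -> {poly K}) psi (w : {poly K}) N d (F : {mpoly K[3]}) : F \is d.-homog ->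
  (forall j, ordge N (mmap polyC psi (Phi j) - w * Q j)) ->
  ordge N (mmap polyC psi (mmap (@mpolyC 2 K) Phi F) - w ^+ d * mmap polyC Q F).
Proof.
move=> hF H; rewrite -(mmap_homog_scale _ _ _ hF) mmap_map_rmorph.
have -> : mmap polyC psi \o @mpolyC 2 K = polyC by apply/funext => c /=; rewrite mmapC.
apply: mmap_congr => //; [exact: ordgeD | exact: ordge_zero | exact: ordgeMr].
Qed.

End Frame.

Lemma mmap_dehomog (C : numClosedFieldType) (Phi : 'I_2 -> {mpoly C[2]}) i (g : {mpoly C[3]}) :
  mmap (@mpolyC 2 C) Phi (dehomog i g) =
  mmap (@mpolyC 2 C) (fun j => if unlift i j is Some k then Phi k else 1) g.
Proof.
rewrite /dehomog /comp_mpoly mmap_map_rmorph.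
have -> : mmap (@mpolyC 2 C) Phi \o @mpolyC 2 C = @mpolyC 2 C by apply/funext => c /=; rewrite mmapC.
congr mmap; apply/funext => j /=; rewrite tnth_mktuple.
by case: unlift => [k|]; rewrite ?mmapXU ?rmorph1.
Qed.

Section LocalHelpers.
Variable K : fieldType.
Local Notation B := {mpoly K[2]}.

Lemma inN_inv (U : B) N : U@_0%MM != 0 -> exists U', inN N (U * U' - 1).
Proof.
move=> U0; case: N => [|N]; first by exists 0.
elim: N => [|N [U' H]].
  exists (U@_0%MM)^-1%:MP; apply: inN1E.
  by rewrite mcoeffB mcoeff0M mcoeffC eqxx mulr1 divff // mcoeff1 eqxx subrr.
exists (U' * (1 - (U * U' - 1))).
have -> : U * (U' * (1 - (U * U' - 1))) - 1 = - ((U * U' - 1) * (U * U' - 1)) by ring.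
by apply/inNN/(inNW (N := N.+1 + N.+1)%N) => //; [lia | apply: inNM].
Qed.

Lemma inN_cancelX (X q : B) n N : ~ inN 2 X -> inN (N + n) (X ^+ n * q) -> inN N q.
Proof.
move=> X2; elim: n q N => [|n IH] q N; first by rewrite addn0 expr0 mul1r.
rewrite exprSr addnS -addSn -mulrA => /IH; rewrite -(addn1 N); exact: inN_cancel.
Qed.
End LocalHelpers.

(** * Vanishing of logarithmic derivations along a curve *)

Section Elimination.
Variable C : numClosedFieldType.
Local Notation S := {mpoly C[3]}.
Local Notation B := {mpoly C[2]}.

(* In the chart [x_i = 1] a nonzero polynomial in [x_a] alone lies in the ideal of
   [f] and its [x_b]-derivative. Evaluating in an arbitrary algebra covers both the
   affine chart and truncated formal coordinates. *)
Definition elim_coord (f : S) (i a b : 'I_3) := exists2 r : {poly C}, r != 0 &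
  forall (T : comNzRingType) (g : {rmorphism C -> T}) (x : 'I_3 -> T), x i = 1 ->
  exists s t, (map_poly g r).[x a] = s * mmap g x f + t * mmap g x f^`M(b).

(** Only the root [va] of the eliminating polynomial matters near the point: the cofactor has
    nonzero constant term and is inverted as a truncated series. *)
Lemma elim_power f i a b va : elim_coord f i a b -> exists n, forall N (x : 'I_3 -> B),
  x i = 1 -> (x a)@_0%MM = va -> exists s t, inN N ((x a - va%:MP) ^+ n
    - (s * mmap (@mpolyC 2 C) x f + t * mmap (@mpolyC 2 C) x f^`M(b))).
Proof.
case=> r r0 Hr; have [n [q]] := multiplicity_XsubC r va; rewrite r0 /= => qva rE.
exists n => N x xi xa; have [s [t]] := Hr _ (@mpolyC 2 C : {rmorphism _ -> _}) x xi.
rewrite rE rmorphM rmorphXn /= map_polyXsubC hornerM horner_exp hornerXsubC.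
set U := (map_poly _ q).[_] => e.
have U0 : U@_0%MM != 0.
  suff -> : U@_0%MM = q.[va] by rewrite -rootE.
  have <- : (x a)@_0%MM = va by [].
  rewrite /U -(horner_map (mcoeff 0%MM)) -map_poly_comp map_poly_id // => c _ /=.
  by rewrite mcoeffC eqxx mulr1.
have [U' HU] := inN_inv N U0; exists (s * U'), (t * U').
have -> : (x a - va%:MP) ^+ n - (s * U' * mmap (@mpolyC 2 C) x f
    + t * U' * mmap (@mpolyC 2 C) x f^`M(b)) = - ((x a - va%:MP) ^+ n * (U * U' - 1)).
  have -> : s * U' * mmap (@mpolyC 2 C) x f + t * U' * mmap (@mpolyC 2 C) x f^`M(b) =
     (s * mmap (@mpolyC 2 C) x f + t * mmap (@mpolyC 2 C) x f^`M(b)) * U' by ring.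
  by rewrite -e; ring.
by apply/inNN/inNMl.
Qed.

End Elimination.

Section JacobianTest.
Variable C : numClosedFieldType.
Local Notation B := {mpoly C[2]}.
Variables (Phi : 'I_3 -> B) (v : 'I_3 -> C) (i : 'I_3).
Variable fr : is_frame Phi v i.

(** The arc lifts the coordinate line through [v] in the direction [a]. Comparing the i-th
    coordinates, both normalized to 1, shows that the scaling factor is 1 to the required order. *)
Lemma frame_coord_arc a N : a != i -> (1 < N)%N -> exists psi,
  [/\ forall k, ordge 1 (psi k), exists k, (psi k)`_1 != 0,
   forall j, j != a -> ordge N (mmap polyC psi (Phi j - (v j)%:MP)) &
   ordge N (mmap polyC psi (Phi a - (v a)%:MP) - 'X)].
Proof.
move=> ai N1; have N0 := ltnW N1.
pose Q j : {poly C} := (v j)%:P + (j == a)%:R *: 'X.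
have Q0 j : (Q j)`_0 = 1 * v j by rewrite coefD coefC coefZ coefX mulr0 addr0 mul1r.
have Q1 j : (Q j)`_1 = (j == a)%:R by rewrite coefD coefC coefZ coefX mulr1 add0r.
have nt : ~ exists x : C, forall j, (Q j)`_1 = x * v j.
  case=> x Hx; have := Hx i; rewrite Q1 (frame_v fr) mulr1 eq_sym (negPf ai) => x0.
  by have := Hx a; rewrite Q1 eqxx -x0 mul0r; apply/eqP/oner_neq0.
have [psi [w [psi1 psi1' w0 H]]] := frame_arc fr (oner_neq0 _) N0 Q0 nt.
have {}H j : ordge N (mmap polyC psi (Phi j) - w * Q j) by apply: ordgeW (H j).
have w1 : ordge N (1 - w).
  have := H i; rewrite /Q eq_sym (negPf ai) scale0r addr0 (frame_v fr) mulr1.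
  by case: fr => -> _ _; rewrite rmorph1.
exists psi; split=> // [j ja|].
  have -> : mmap polyC psi (Phi j - (v j)%:MP) =
      (mmap polyC psi (Phi j) - w * Q j) - (1 - w) * (v j)%:P.
    by rewrite mmapB mmapC /Q (negPf ja) scale0r addr0; ring.
  by apply: ordgeB => //; apply: ordgeMr.
have -> : mmap polyC psi (Phi a - (v a)%:MP) - 'X =
    (mmap polyC psi (Phi a) - w * Q a) - (1 - w) * ((v a)%:P + 'X).
  by rewrite mmapB mmapC /Q eqxx scale1r; ring.
by apply: ordgeB => //; apply: ordgeMr.
Qed.

Lemma frame_coord_lin a : a != i ->
  exists k, (Phi a - (v a)%:MP)@_U_(k) != 0.
Proof.
move=> ai; apply: contrapT => /forallNP H.
have [x [y e]] := frame_span fr (fun j => (j == a)%:R).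
have := e i; rewrite eq_sym (negPf ai) big1 => [|k _]; last by rewrite (frame_deriv_i fr) mulr0.
case: (fr) => _ P0 _; rewrite P0 (frame_v fr) mulr1 add0r => y0.
have /eqP := e a; rewrite eqxx -y0 mul0r addr0 big1 => [|k _]; first by rewrite oner_eq0.
have /negP := H k; rewrite negbK mcoeffB mcoeffC mnm1_eq0 mulr0 subr0 mcoeffU_deriv.
by move=> /eqP ->; rewrite mulr0.
Qed.

(* The two coordinates form a regular sequence: this is where a reduced curve,
   whose Jacobian ideal has finite colength, is distinguished from a multiple one. *)
Lemma frame_jacobian_cancel (f : {mpoly C[3]}) a b n1 n2 k M (D : B) :
  a != i -> b != i -> a != b ->
  let F := mmap (@mpolyC 2 C) Phi f in
  let G j := mmap (@mpolyC 2 C) Phi f^`M(j) in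
  ~ inN k.+1 F ->
  (exists s t, inN M ((Phi a - (v a)%:MP) ^+ n1 - (s * F + t * G b))) ->
  (exists s t, inN M ((Phi b - (v b)%:MP) ^+ n2 - (s * F + t * G a))) ->
  (forall j, exists g, inN M (D * G j - g * F)) ->
  exists g, inN (M - k - n2 - n1 - n1) (D - g * F).
Proof.
move=> ai bi ab F G Fk; set X := Phi a - _; set Y := Phi b - _.
move=> [s1 [t1 H1]] [s2 [t2 H2]] HD.
have [Mk|kM] := ltnP M k.
  by exists 0; rewrite (eqP (ltnW Mk : (M - k)%N == 0%N)) !sub0n.
have divD c n s t j : inN M (c ^+ n - (s * F + t * G j)) ->
    exists p, inN M (D * c ^+ n - p * F).
  move=> H; have [g Hg] := HD j; exists (D * s + t * g).
  have -> : D * c ^+ n - (D * s + t * g) * F =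
     D * (c ^+ n - (s * F + t * G j)) + t * (D * G j - g * F) by ring.
  by apply: inND; apply: inNMl.
have [p Hp] := divD _ _ _ _ _ H1; have [q Hq] := divD _ _ _ _ _ H2.
(* Both [p * Y ^+ n2] and [q * X ^+ n1] are quotients of [D * X ^+ n1 * Y ^+ n2] by [F]; cancelling
   [F], of order at most k, costs k orders. *)
have Hpq : inN (M - k) (p * Y ^+ n2 - q * X ^+ n1).
  apply: (inN_cancel Fk); rewrite subnK //.
  have -> : F * (p * Y ^+ n2 - q * X ^+ n1) =
    (D * Y ^+ n2 - q * F) * X ^+ n1 - (D * X ^+ n1 - p * F) * Y ^+ n2 by ring.
  by apply: inNB; apply: inNMr.
have [psi [psi1 psi1' Ha Hb]] := frame_coord_arc (N := (M - k).+2) bi isT.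
have coord0 j : (Phi j - (v j)%:MP)@_0%MM = 0.
  by case: fr => _ P0 _; rewrite mcoeffB P0 mcoeffC eqxx mulr1 subrr.
have XN : ordge (M - k).+2 (mmap polyC psi X) by apply: Ha.
have YN : ordge 2 (mmap polyC psi Y - 'X) by apply: ordgeW Hb.
have [g Hg] := arc_regular psi1 psi1' (coord0 a) (frame_coord_lin ai) (coord0 b)
  XN YN (leq_trans (leqnSn _) (leqnSn _)) Hpq.
exists g; have X2 : ~ inN 2 X.
  by move=> X2; have [j /eqP] := frame_coord_lin ai; apply; apply: X2; rewrite mdeg1.
have [nM|Mn] := leqP n1 (M - k - n2 - n1)%N; last first.
  by rewrite (eqP (ltnW Mn : (_ - n1)%N == 0%N)).
apply: (inN_cancelX (n := n1) X2); rewrite subnK //.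
have -> : X ^+ n1 * (D - g * F) = (D * X ^+ n1 - p * F) + (p - g * X ^+ n1) * F by ring.
by apply: inND; [apply: inNW Hp; lia | apply: inNMr].
Qed.

End JacobianTest.

Lemma cross3_eq0 (R : comNzRingType) (t v : 'I_3 -> R) i :
  (forall j, cross3 t v j = 0) -> v i = 1 -> forall j, t j = t i * v j.
Proof.
move=> H vi j; rewrite -[LHS]mulr1 -{}vi.
have := H 0; have := H 1; have := H 2%:R; rewrite /cross3 !ordS3.
move=> /subr0_eq e2 /subr0_eq e1 /subr0_eq e0.
by elim/ord3_ind: j; elim/ord3_ind: i.
Qed.

Lemma sum_delta (R : nzRingType) n (h : 'I_n -> R) j :
  \sum_i h i * (i == j)%:R = h j.
Proof.
by rewrite (bigD1 j) //= eqxx mulr1 big1 ?addr0 // => i /negPf ->; rewrite mulr0.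
Qed.

Section LocalTangency.
Variable C : numClosedFieldType.
Local Notation S := {mpoly C[3]}.
Local Notation B := {mpoly C[2]}.

Lemma coef1M (p q : {poly C}) : ordge 1 p -> (p * q)`_1 = p`_1 * q`_0.
Proof. by move=> p1; have := ordge_coefM p1 (ordge0 q); rewrite addn0. Qed.

(** The linear part of the Euler field is diagonal with positive weights, so it sends the tangent
    vector of the arc to a nonzero vector. Its image under the differential of [Phi] is nonzero with
    i-th coordinate zero, hence not proportional to [v], whose i-th coordinate is 1. *)
Lemma frame_tangent_cross (Phi : 'I_3 -> B) v i (psi : 'I_2 -> {poly C}) w (u : B) :
  is_frame Phi v i -> (forall k, ordge 1 (psi k)) -> (exists k, (psi k)`_1 != 0) ->
  (forall k, (0 < w k)%N) -> u@_0%MM != 0 ->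
  exists j, ~ ordge 2 (mmap polyC psi (cross3 (fun j => u * wfield w (Phi j)) Phi j)).
Proof.
move=> fr psi1 [k0 psik] w0 u0; have [Pi P0 _] := fr.
pose T j := u * wfield w (Phi j).
have T0 j : (mmap polyC psi (T j))`_0 = 0.
  rewrite rmorphM coef0M arc_coef0 //; apply/eqP; rewrite mulf_eq0 (negPf u0) /=.
  rewrite arc_coef0 //; apply/eqP; rewrite /wfield raddf_sum big1 // => k _ /=.
  by rewrite mcoeffZ mcoeff0M mcoeffX mnm1_eq0 mul0r mulr0.
pose t j := (mmap polyC psi (T j))`_1.
have tE j : t j = \sum_k (u@_0%MM * (w k)%:R * (psi k)`_1) * ((Phi j)^`M(k))@_0%MM.
  rewrite /t /T rmorphM /= mulrC coef1M; last first.
    case=> // _; have /eqP := T0 j; rewrite rmorphM coef0M mulf_eq0 /= arc_coef0 //.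
    by rewrite (negPf u0) => /eqP.
  rewrite arc_coef0 // mulrC {1}/wfield raddf_sum coef_sum mulr_sumr; apply: eq_bigr => k _ /=.
  by rewrite mmapZ rmorphM /= mmapXU coefCM coef1M // arc_coef0 // !mulrA.
have ti : t i = 0.
  by rewrite tE big1 // => k _; rewrite (frame_deriv_i fr) mulr0.
have Pc j : (mmap polyC psi (Phi j))`_0 = v j by rewrite arc_coef0.
have crossE j : (mmap polyC psi (cross3 T Phi j))`_1 = cross3 t v j.
  have TM a b : (mmap polyC psi (T a * Phi b))`_1 = t a * v b.
    have o : ordge 1 (mmap polyC psi (T a)) by case.
    by rewrite rmorphM coef1M // Pc.
  by rewrite /cross3 mmapB coefB !TM.
apply: contrapT => /forallNP H.
have c0 j : cross3 t v j = 0.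
  rewrite -crossE; have := H j; rewrite -/T => /contrapT; apply=> //.
have t0 j : t j = 0.
  by rewrite (cross3_eq0 c0 (frame_v fr)) ti mul0r.
have := frame_indep fr (a := fun k => u@_0%MM * (w k)%:R * (psi k)`_1).
move=> /(_ _ k0) e; apply/negP: psik; rewrite negbK.
have /eqP := e (fun j => etrans (esym (tE j)) (t0 j)).
by rewrite !mulf_eq0 (negPf u0) pnatr_eq0 eqn0Ngt w0.
Qed.

Lemma germ_frame (g : S) i (v : 'I_3 -> C) N : (1 < N)%N -> v i = 1 ->
  quasihomog_germ (dehomog i g) (fun k => v (lift i k)) ->
  exists Phi u w gam, [/\ is_frame Phi v i, (forall k, (0 < w k)%N), u@_0%MM != 0 &
    let G := mmap (@mpolyC 2 C) Phi g in inN N (u * wfield w G - gam * G)].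
Proof.
move=> N1 vi /quasihomog_germ_trunc /(_ N N1) [Phi [u [w [d [h [P0 detP u0 [w0 hh] H]]]]]].
pose Phi3 j := if unlift i j is Some k then Phi k else 1.
rewrite mmap_dehomog -/Phi3 in H.
(* With E the Euler field, [G = u * h] and [E h = d * h] give [u * E G = (E u + d * u) * G]. *)
exists Phi3, u, w, (wfield w u + d%:R *: u); split=> //.
  split; first by rewrite /Phi3 unlift_none.
    move=> j; rewrite /Phi3; case: unliftP => [k|] ->; first by rewrite P0.
    by rewrite mcoeff1 eqxx vi.
  have <- : \matrix_(k < 2, j < 2) (Phi k)@_U_(j) = \matrix_(k, j) (Phi3 (lift i k))@_U_(j) => //.
  by apply/matrixP => k j; rewrite !mxE /Phi3 liftK.
move=> G; rewrite -/G in H; set E := _ - _ in H.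
have GE : G = u * h + E by rewrite /E addrC subrK.
have wG : wfield w G = wfield w u * h + u * (d%:R *: h) + wfield w E.
  by rewrite {1}GE raddfD /= wfieldM (wfield_weighted hh).
have -> : u * wfield w G - (wfield w u + d%:R *: u) * G =
   u * wfield w E - (wfield w u + d%:R *: u) * E.
  rewrite wG -!mul_mpolyC; move: (d%:R%:MP) => c; rewrite [in LHS]GE; ring.
by apply: inNB; apply: inNMl => //; apply: wfield_inN.
Qed.

(** Here [tf] and [tl] stand for the Euler derivatives of [f] and [l]: where [l] vanishes to order
    N, the Leibniz rule leaves only the term with [tl]. *)
Lemma ordge_key N (u f tl tf l g : {poly C}) : ordge N l ->
  ordge N (u * (tf * l + f * tl) - g * (f * l)) -> ordge N (u * (f * tl)).
Proof.
move=> lN H; have -> : u * (f * tl) = (u * (tf * l + f * tl) - g * (f * l))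
  - (u * tf - g * f) * l by ring.
by apply: ordgeB => //; apply: ordgeMl.
Qed.

(** Budget of orders: k + 1 for cancelling [F] along the arc, one for cancelling [L], then k + 1,
    n2, n1 and n1 in [frame_jacobian_cancel]; k + 1 orders must survive. *)
Lemma precision_bounds k n1 n2 : exists M N, [/\ (1 < N)%N,
  (k.+2 <= N)%N, (M + 1 <= N)%N, (M + 1 <= N - k.+1)%N &
  (k.+1 <= M - k.+1 - n2 - n1 - n1)%N /\ (k.+1 <= N - k.+1)%N].
Proof.
exists (2 * k.+1 + n2 + n1 + n1)%N, (2 * k.+1 + n2 + n1 + n1 + k.+1 + 1)%N.
by split; first (by lia); try (by lia); split; lia.
Qed.

Lemma solve_first_summand (V : zmodType) (t x y z : V) : t = x + y + z -> x = t - z - y.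
Proof. by move=> ->; rewrite !addrK. Qed.

Local Opaque mmap wfield mderiv.

Lemma inN_arc_contra (psi : 'I_2 -> {poly C}) k F : (forall i, ordge 1 (psi i)) ->
  ~ ordge k (mmap polyC psi F) -> ~ inN k F.
Proof. by move=> psi1 nF /(arc_inN psi1) []. Qed.

Lemma local_tangency (f l : S) (e D : nat) i (v : 'I_3 -> C) (Q : 'I_3 -> {poly C}) c k
    (delta : 'I_3 -> S) s :
  f \is e.-homog -> l \is D.-homog -> v i = 1 -> c != 0 ->
  quasihomog_germ (dehomog i (f * l)) (fun k => v (lift i k)) ->
  (forall a b, a != i -> b != i -> a != b -> elim_coord f i a b) ->
  (forall j, (Q j)`_0 = c * v j) -> (~ exists x : C, forall j, (Q j)`_1 = x * v j) ->
  mmap polyC Q l = 0 -> (exists j, (l^`M(j)).@[v] != 0) ->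
  ordge k (mmap polyC Q f) -> ~ ordge k.+1 (mmap polyC Q f) ->
  \sum_j delta j * f^`M(j) = 0 -> \sum_j delta j * l^`M(j) \is s.-homog ->
  ordge k.-1 (mmap polyC Q (\sum_j delta j * l^`M(j))).
Proof.
move=> hf hl vi c0 germ elim Q0 Q1 Ql lv fk fk1 df hdl.
case: k fk fk1 => // k fk fk1 /=.
pose a := lift i (0 : 'I_2); pose b := lift i (1 : 'I_2).
have ai : a != i by rewrite eq_sym neq_lift.
have bi : b != i by rewrite eq_sym neq_lift.
have ab : a != b by rewrite (inj_eq lift_inj).
have ba : b != a by rewrite eq_sym.
have [n1 H1] := elim_power (v a) (elim a b ai bi ab).
have [n2 H2] := elim_power (v b) (elim b a bi ai ba).
have [M [N [N1 kN MN MN' [kM kN'']]]] := precision_bounds k n1 n2.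
have [Phi [u [w [gam [fr w0 u0]]]]] := germ_frame N1 vi germ.
rewrite /= rmorphM /=.
have [F FE] : {F | F = mmap (@mpolyC 2 C) Phi f} by eexists.
have [L LE] : {L | L = mmap (@mpolyC 2 C) Phi l} by eexists.
rewrite -FE -LE => HG.
have [Pi P0 _] := fr.
have [psi [om [psi1 psi1' om0 Hpsi]]] := frame_arc fr c0 (ltnW N1) Q0 Q1.
have {}Hpsi j : ordge N (mmap polyC psi (Phi j) - om * Q j) by apply: ordgeW (Hpsi j).
have arcE d (G : S) : G \is d.-homog ->
    ordge N (mmap polyC psi (mmap (@mpolyC 2 C) Phi G) - om ^+ d * mmap polyC Q G).
  by move=> hG; apply: mmap_arc.
have omX d : (om ^+ d)`_0 != 0 by rewrite -horner_coef0 horner_exp expf_neq0 // horner_coef0.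
have psiL : ordge N (mmap polyC psi L).
  by have := arcE _ _ hl; rewrite Ql mulr0 subr0 -LE.
have psiF' := arcE _ _ hf; rewrite -FE in psiF'.
have psiF : ordge k.+1 (mmap polyC psi F).
  rewrite -[mmap _ _ _](subrK (om ^+ e * mmap polyC Q f)); apply: ordgeD; last exact: ordgeMl.
  exact: ordgeW (ltnW kN) psiF'.
have psiF1 : ~ ordge k.+2 (mmap polyC psi F).
  move=> H; apply: fk1; apply: (ordge_unit_cancel (omX e)).
  rewrite -[_ * _](subKr (mmap polyC psi F)); apply: ordgeB => //.
  exact: ordgeW kN psiF'.
have L0 : L@_0%MM = 0 by rewrite -(arc_coef0 L psi1); exact: psiL (ltnW N1).
have mcoeff0_Phi (G : S) : (mmap (@mpolyC 2 C) Phi G)@_0%MM = G.@[v].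
  rewrite /meval (mmap_map_rmorph (@mpolyC 2 C) (mcoeff 0%MM)); congr mmap.
    by apply/funext => x /=; rewrite mcoeffC eqxx mulr1.
  by apply/funext => j /=; rewrite P0.
have chain (d : {additive B -> B}) G : (forall x y, d (x * y) = d x * y + x * d y) ->
    (forall x, d x%:MP = 0) -> d (mmap (@mpolyC 2 C) Phi G) =
    \sum_j mmap (@mpolyC 2 C) Phi G^`M(j) * d (Phi j).
  by move=> dM dC; apply: mmap_chain_rule.
(* Otherwise the gradient of [l] at [v] would annihilate the tangent directions of the frame, and
   [v] itself by Euler's identity, hence all vectors by [frame_span]. *)
have L1 : exists q, L@_U_(q) != 0.
  apply: contrapT => /forallNP H; have [j /negP] := lv; apply.
  have [x [y exy]] := frame_span fr (fun j' => (j' == j)%:R).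
  have -> : (l^`M(j)).@[v] = \sum_j' (l^`M(j')).@[v] * (j' == j)%:R.
    by rewrite sum_delta.
  under eq_bigr => j' _ do rewrite exy mulrDr mulr_sumr.
  rewrite big_split exchange_big /= big1 ?add0r => [|q _].
    have := congr1 (fun G => G.@[v]) (euler_mderiv hl); rewrite raddf_sum /= => ev.
    apply/eqP; transitivity (y * (\sum_j' (('X_j' * l^`M(j')).@[v]))).
      by rewrite mulr_sumr; apply: eq_bigr => j' _; rewrite mevalM mevalXU P0; ring.
    by rewrite ev mevalM -(mcoeff0_Phi l) -LE L0 !mulr0.
  have /negP := H q; rewrite negbK mcoeffU_deriv LE (chain (mderiv q)).
  - rewrite raddf_sum /= => /eqP e0.
    rewrite -[RHS](mulr0 (x q)) -[in RHS]e0 mulr_sumr.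
    by apply: eq_bigr => j' _; rewrite mcoeff0M mcoeff0_Phi; ring.
  - by move=> p q' /=; rewrite mderivM.
  by move=> z /=; rewrite mderivC.
have LN2 : ~ inN 2 L by move=> L2; have [q /eqP] := L1; apply; apply: L2; rewrite mdeg1.
(* On the arc the terms containing [L] disappear from the tangency relation for [F * L]; what
   remains is a multiple of [F], whose order is exactly k + 1 and can be cancelled. *)
have uL : ordge (N - k.+1) (mmap polyC psi (wfield w L)).
  have kN' : (k.+1 <= N)%N := ltnW kN.
  apply: (ordge_cancel psiF1); rewrite (subnK kN').
  have u0' : (mmap polyC psi u)`_0 != 0 by rewrite arc_coef0.
  apply: (ordge_unit_cancel u0').
  have : ordge N (mmap polyC psi (u * wfield w (F * L) - gam * (F * L))).
    by have [] := arc_inN psi1 HG.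
  rewrite wfieldM mmapB !rmorphM /= mmapD !rmorphM /= => HH.
  exact: ordge_key psiL HH.
have [g Hg] := arc_division psi1 psi1' L0 L1 psiL (leq_subr _ _) uL.
(* Since the Euler field maps [L] to a multiple of [L], the Leibniz rule for [F * L], divided by
   [L], gives the same for [F]. *)
have uF : inN M (u * wfield w F - (gam - u * g) * F).
  apply: (inN_cancel (p := L) LN2).
  have -> : L * (u * wfield w F - (gam - u * g) * F) =
     (u * wfield w (F * L) - gam * (F * L)) - u * F * (wfield w L - g * L).
    by rewrite wfieldM; move: (wfield w F) (wfield w L) => wF wL; ring.
  apply: inNB; first exact: inNW MN HG.
  exact/inNMl/(inNW MN' Hg).
pose T j := u * wfield w (Phi j).
pose del j := mmap (@mpolyC 2 C) Phi (delta j).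
pose grad (G : S) j := mmap (@mpolyC 2 C) Phi G^`M(j).
have gradT G : dot3 (grad G) T = u * wfield w (mmap (@mpolyC 2 C) Phi G).
  rewrite (chain (wfield w)); [|exact: wfieldM|exact: wfieldC].
  by rewrite mulr_sumr; apply: eq_bigr => j _; rewrite mulrCA.
have gradPhi d G : G \is d.-homog ->
    dot3 (grad G) Phi = d%:R * mmap (@mpolyC 2 C) Phi G.
  move=> hG; have := congr1 (mmap (@mpolyC 2 C) Phi) (euler_mderiv hG).
  rewrite raddf_sum rmorphM rmorph_nat /= => <-; apply: eq_bigr => j _.
  by rewrite rmorphM /= mmapXU mulrC.
have graddel G : dot3 (grad G) del = mmap (@mpolyC 2 C) Phi (\sum_j delta j * G^`M(j)).
  by rewrite raddf_sum; apply: eq_bigr => j _; rewrite /= rmorphM /= mulrC.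
pose Del := det3 del T Phi.
(* Cramer's rule with the gradient of [f]: the pairing with [del] is zero, those with [T] and [Phi]
   are multiples of [F], by tangency and by Euler's identity. *)
have HDel j : exists g', inN M (Del * grad f j - g' * F).
  exists ((gam - u * g) * cross3 Phi del j + e%:R * cross3 del T j).
  rewrite cramer3 graddel df mmap0 mul0r add0r gradT (gradPhi _ _ hf) -FE.
  move: (cross3 T Phi j) (cross3 Phi del j) (cross3 del T j) (e%:R : B) => A A'' A' E.
  have -> : u * wfield w F * A'' + E * F * A' - ((gam - u * g) * A'' + E * A') * F =
     (u * wfield w F - (gam - u * g) * F) * A'' by move: (wfield w F) => wF; ring.
  exact: inNMr.
have [g' Hg'] : exists g', inN (M - k.+1 - n2 - n1 - n1) (Del - g' * F).
  rewrite FE; apply: (frame_jacobian_cancel fr ai bi ab (f := f)).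
  - by rewrite -FE; apply: inN_arc_contra psiF1.
  - exact: H1 Pi (P0 a).
  - exact: H2 Pi (P0 b).
  - by rewrite -FE.
have psiDel : ordge k.+1 (mmap polyC psi Del).
  rewrite -[Del](subrK (g' * F)) mmapD; apply: ordgeD.
    by have [H' _] := arc_inN psi1 Hg'; apply: ordgeW kM H'.
  by rewrite rmorphM; apply: ordgeMl.
have [j Hj] := frame_tangent_cross fr psi1 psi1' w0 u0.
(* Cramer's rule with the gradient of [l]: its pairings with [T] and [Phi] vanish to high order
   along the arc, so the determinant controls the pairing with [del], up to the single order taken
   by the vector product of [T] and [Phi]. *)
have Ldel : ordge k (mmap polyC psi (mmap (@mpolyC 2 C) Phi (\sum_j delta j * l^`M(j)))).
  apply: (ordge_cancel Hj); rewrite addn1 -rmorphM /= mulrC -graddel.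
  have := cramer3 del T Phi (grad l) j; rewrite gradT (gradPhi _ _ hl) -LE -/Del.
  move/solve_first_summand => ->.
  rewrite mmapB mmapB !rmorphM /=; apply: ordgeB; first apply: ordgeB.
  - exact: ordgeMr.
  - exact/ordgeMr/ordgeMl/(ordgeW (ltnW kN) psiL).
  exact/ordgeMr/ordgeMl/(ordgeW kN'' uL).
apply: (ordge_unit_cancel (omX s)).
rewrite -[_ * _](subKr (mmap polyC psi (mmap (@mpolyC 2 C) Phi (\sum_j delta j * l^`M(j))))).
apply: ordgeB => //; exact: ordgeW (ltnW (ltnW kN)) (arcE _ _ hdl).
Qed.

End LocalTangency.

(** * Reduced curves in affine charts *)

Section PrimeElements.
Variable R : idomainType.
Implicit Types (p a b f g : R) (ps : seq R).

Definition divides p a := exists q, a = p * q.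

Definition prime_elt p := p <> 0 /\
  forall a b, divides p (a * b) -> divides p a \/ divides p b.

Lemma prime_elt_ker (R' : idomainType) (s : {rmorphism R -> R'}) p : p <> 0 ->
  s p = 0 -> (forall a, s a = 0 -> divides p a) -> prime_elt p.
Proof.
move=> p0 sp ker; split=> // a b [q /(congr1 s)].
rewrite !rmorphM sp mul0r => /eqP; rewrite mulf_eq0.
by case/orP => /eqP /ker; [left | right].
Qed.

(** Clears denominators while keeping the square. A prime dividing [g] is moved to [m], its second
    copy joining the cofactor [b]; a prime dividing [b] is moved to [m']. The primes will be linear
    polynomials in one coordinate, or a homogeneous coordinate. *)
Lemma prime_square_descent ps f g b : (forall p, p \in ps -> prime_elt p) ->
  (\prod_(p <- ps) p) * f = g ^+ 2 * b ->
  exists m m' g' b', [/\ m * m' = \prod_(p <- ps) p, g = m * g' & f = g' ^+ 2 * b'].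
Proof.
elim: ps g b => [|p ps IH] g b prm.
  by rewrite big_nil mul1r => ->; exists 1, 1, g, b; rewrite !mul1r.
have [p0 pP] := prm p (mem_head _ _).
have {}prm q : q \in ps -> prime_elt q by move=> qs; apply: prm; rewrite inE qs orbT.
rewrite !big_cons -mulrA => e.
have pI x y : p * x = p * y -> x = y by apply: mulfI; apply/eqP.
have gE g1 : g = p * g1 -> exists m m' g' b',
    [/\ m * m' = p * \prod_(p <- ps) p, g = m * g' & f = g' ^+ 2 * b'].
  move=> gE; have [|m [m' [g' [b' [mm gm fE]]]]] := IH g1 (p * b) prm.
    by apply: pI; rewrite e gE; ring.
  by exists (p * m), m', g', b'; rewrite -mulrA mm gE gm mulrA.
have : divides p (g ^+ 2 * b) by exists ((\prod_(j <- ps) j) * f).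
case/pP => [|[b1 bE]]; first by rewrite expr2 => /pP[] [g1 /gE].
have [|m [m' [g' [b' [mm gm fE]]]]] := IH g b1 prm.
  by apply: pI; rewrite e bE; ring.
by exists m, (p * m'), g', b'; rewrite mulrCA mm.
Qed.

Lemma prime_prod_cancel ps a b c : (forall p, p \in ps -> prime_elt p /\ ~ divides p c) ->
  (\prod_(p <- ps) p) * b = a * c -> divides (\prod_(p <- ps) p) a.
Proof.
elim: ps a => [|p ps IH] a prm; first by rewrite big_nil mul1r => _; exists a; rewrite mul1r.
have [[p0 pP] pc] := prm p (mem_head _ _).
have {}prm q : q \in ps -> prime_elt q /\ ~ divides q c.
  by move=> qs; apply: prm; rewrite inE qs orbT.
rewrite !big_cons -mulrA => e.
have : divides p (a * c) by exists ((\prod_(j <- ps) j) * b).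
case/pP => [[a1 aE]|//]; have [|a2 a2E] := IH a1 prm.
  by apply: (mulfI (introN eqP p0)); rewrite e aE mulrA.
by exists a2; rewrite aE a2E mulrA.
Qed.

End PrimeElements.

Lemma ord3_index (i a b j : 'I_3) : a != i -> b != i -> a != b ->
  j != a -> j != b -> j = i.
Proof.
rewrite -!val_eqE /= => ai bi ab ja jb; apply: val_inj => /=.
move: (ltn_ord j) (ltn_ord a) (ltn_ord b) (ltn_ord i); lia.
Qed.

Lemma dhomog_mX n (R : nzRingType) (i : 'I_n) : ('X_i : {mpoly R[n]}) \is 1.-homog.
Proof. by rewrite dhomogX; apply/eqP; apply: mdeg1. Qed.

Lemma dhomog_mXn n (R : comNzRingType) (i : 'I_n) k :
  ('X_i : {mpoly R[n]}) ^+ k \is k.-homog.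
Proof. by have := dhomogMn k (dhomog_mX R i); rewrite mul1n. Qed.

Section Charts.
Variable C : numClosedFieldType.
Local Notation S := {mpoly C[3]}.
Local Notation A := {poly {poly C}}.

Lemma prime_XsubC2 (x : C) : prime_elt ('X - x%:P)%:P%R.
Proof.
apply: (@prime_elt_ker _ _ (map_poly (horner_eval x))).
- by apply/eqP; rewrite polyC_eq0 polyXsubC_eq0.
- by rewrite /= map_polyC /= horner_evalE hornerXsubC subrr.
move=> P /polyP P0; exists (\poly_(i < size P) (P`_i %/ ('X - x%:P))).
apply/polyP => i; rewrite coefCM coef_poly; case: ltnP => [_|/leq_sizeP ->//]; last by rewrite mulr0.
rewrite mulrC divpK // dvdp_XsubCl /root.
by have := P0 i; rewrite coef_map coef0 /= horner_evalE => ->.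
Qed.

Lemma closed_prod_XsubC (r : {poly C}) : r != 0 -> exists c (xs : seq C), c != 0 /\
  r%:P = c%:P%:P * \prod_(p <- [seq ('X - x%:P)%:P | x <- xs]) p :> A.
Proof.
move=> r0; have [xs rE] := closed_field_poly_normal r.
exists (lead_coef r), xs; rewrite lead_coef_eq0; split=> //.
by rewrite {1}rE -mul_polyC polyCM rmorph_prod big_map.
Qed.

Lemma prime_mX i : prime_elt ('X_i : S).
Proof.
pose s := mmap (@mpolyC 3 C) (fun j => if j == i then 0 else 'X_j).
apply: (@prime_elt_ker _ _ s); first by apply/eqP; rewrite -msize_poly_eq0 msizeX.
  by rewrite /s /= mmapXU eqxx.
move=> F sF; have : divides 'X_i (mmap (@mpolyC 3 C) (fun j => 'X_j) F - s F).
  apply: mmap_congr => [a b [q ->] [q' ->]||a b [q ->]|j].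
  - by exists (q + q'); rewrite mulrDr.
  - by exists 0; rewrite mulr0.
  - by exists (q * b); rewrite mulrA.
  by case: eqP => [->|_]; [exists 1; rewrite subr0 mulr1 | exists 0; rewrite subrr mulr0].
by rewrite mmap_idX (sF : s F = 0) subr0.
Qed.

Lemma mXn_prod i k : ('X_i : S) ^+ k = \prod_(p <- nseq k 'X_i) p.
Proof. by rewrite big_nseq; elim: k => // k IH; rewrite exprS IH. Qed.

Lemma not_divides_mX i j k : i != j -> ~ divides ('X_i : S) ('X_j ^+ k).
Proof.
move=> ij [q /(congr1 (meval (fun m => (m == j)%:R)))].
rewrite mevalM rmorphXn /= !mevalXU eqxx expr1n (negPf ij) mul0r.
by move/eqP; rewrite oner_eq0.
Qed.

Variables (i a b : 'I_3).
Variables (ai : a != i) (bi : b != i) (ab : a != b).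

Lemma chart_index j : j != a -> j != b -> j = i.
Proof.
exact: ord3_index.
Qed.

(** The outer variable is [x_b], with coefficients polynomial in [x_a], so that the theory of
    polynomials in one variable applies to the derivative in [x_b]. *)
Definition chart_var (j : 'I_3) : A := if j == a then 'X%:P else if j == b then 'X else 1.

Definition chart : S -> A := mmap (polyC \o polyC) chart_var.

HB.instance Definition _ := GRing.RMorphism.on chart.

Lemma chartC c : chart c%:MP = c%:P%:P.
Proof. by rewrite /chart mmapC. Qed.

Lemma chartX j : chart 'X_j = chart_var j.
Proof. by rewrite /chart mmapXU. Qed.

Lemma chartXi : chart 'X_i = 1.
Proof. by rewrite chartX /chart_var ![i == _]eq_sym (negPf ai) (negPf bi). Qed.

Lemma chartM F G : chart (F * G) = chart F * chart G.
Proof. exact: (rmorphM chart). Qed.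

Lemma chartB F G : chart (F - G) = chart F - chart G.
Proof. exact: (rmorphB chart). Qed.

Lemma chartXiM n F : chart ('X_i ^+ n * F) = chart F.
Proof. by rewrite chartM (rmorphXn chart) /= chartXi expr1n mul1r. Qed.

Lemma chart_deriv F : (chart F)^`() = chart F^`M(b).
Proof.
have -> : (chart F)^`() = \sum_j chart F^`M(j) * (chart_var j)^`().
  apply: (@mmap_chain_rule 3 C A (polyC \o polyC) deriv chart_var F); first exact: derivM.
  by move=> c /=; rewrite derivC.
rewrite (bigD1 b) //= big1 => [|j jb]; rewrite /chart_var.
  by rewrite eq_sym (negPf ab) eqxx derivX mulr1 addr0.
by rewrite (negPf jb); case: ifP => _; rewrite ?derivC ?derivE mulr0.
Qed.

Lemma coef_chart F u v : (chart F)`_v`_u =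
  \sum_(m <- msupp F) F@_m * ((m a == u) && (m b == v))%:R.
Proof.
rewrite /chart /mmap !coef_sum; apply: eq_bigr => m _.
have -> : mmap1 chart_var m = ('X^(m a))%:P * 'X^(m b).
  rewrite /mmap1 (bigD1 a) //= (bigD1 b) 1?eq_sym //= big1 => [|j /andP[ja jb]].
    by rewrite mulr1 /chart_var eqxx [b == a]eq_sym (negPf ab) eqxx polyC_exp.
  by rewrite /chart_var (negPf ja) (negPf jb) expr1n.
rewrite /= !coefCM coefXn mulr_natr; case: eqP => [->|]; last first.
  by rewrite eq_sym => /eqP; rewrite mulr0n coef0 mulr0 eq_sym => /negPf ->; rewrite andbF mulr0.
by rewrite eqxx andbT mulr1n coefXn eq_sym.
Qed.

(** The degree determines the exponent of ['X_i], so distinct monomials of [F] have distinct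
    images. *)
Lemma chart_inj F n : F \is n.-homog -> chart F = 0 -> F = 0.
Proof.
move=> hF cF; apply/mpolyP => m; rewrite mcoeff0.
have [mF|/memN_msupp_eq0 //] := boolP (m \in msupp F).
have := coef_chart F (m a) (m b); rewrite cF !coef0 (bigD1_seq m) ?msupp_uniq //= !eqxx.
rewrite mulr1 big1_seq ?addr0 // => k /andP[km kF]; case: eqP => [ka|_]; last by rewrite mulr0.
case: eqP => [kb|_]; last by rewrite mulr0.
have degE : mdeg k = mdeg m.
  by rewrite ((dhomogP _ _ _ hF) k kF) ((dhomogP _ _ _ hF) m mF).
case/eqP: km; apply/mnmP => j.
have sumE (m' : 'X_{1..3}) : mdeg m' = (m' a + m' b + m' i)%N.
  rewrite mdegE (bigD1 a) //= (bigD1 b) 1?eq_sym //= (bigD1 i) /=; last by rewrite ![i == _]eq_sym ai bi.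
  rewrite big1 ?addn0 ?addnA // => j' /andP[/andP[ja jb]].
  by rewrite (chart_index ja jb) eqxx.
have [->//|ja] := eqVneq j a; have [->//|jb] := eqVneq j b.
rewrite (chart_index ja jb); move: degE; rewrite !sumE ka kb; exact: addnI.
Qed.

(** Homogenization by powers of ['X_i]. All large degrees are reached, so that lifts can be matched
    in degree with other forms. *)
Lemma chart_surj (P : A) : exists n0, forall n, (n0 <= n)%N ->
  exists2 F : S, F \is n.-homog & chart F = P.
Proof.
pose H (P : A) := exists n0, forall n, (n0 <= n)%N -> exists2 F : S, F \is n.-homog & chart F = P.
have HD p q : H p -> H q -> H (p + q).
  case=> n1 H1 [n2 H2]; exists (maxn n1 n2) => n; rewrite geq_max => /andP[/H1[F hF <-] /H2[G hG <-]].
  by exists (F + G); [apply: dhomogD | rewrite rmorphD].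
have HM p j : H p -> H (p * chart_var j).
  case=> n1 H1; exists n1.+1 => -[//|n]; rewrite ltnS => /H1[F hF <-].
  exists (F * 'X_j); last by rewrite rmorphM /= chartX.
  by rewrite -(addn1 n); apply: dhomogM => //; apply: dhomog_mX.
have HC c : H c%:P%:P.
  exists 0%N => n _; exists (c%:MP * 'X_i ^+ n); last first.
    by rewrite rmorphM rmorphXn /= chartXi expr1n mulr1 chartC.
  rewrite mul_mpolyC; apply: dhomogZ; exact: dhomog_mXn.
have HP p : H p%:P.
  elim/poly_ind: p => [|p c IH]; first by rewrite -polyC0; apply: HC.
  rewrite polyCD polyCM; apply: HD => //; have := HM _ a IH.
  by rewrite /chart_var eqxx.
elim/poly_ind: P => [|P p IH]; first by rewrite -polyC0; apply: HP.
apply: HD => //; have := HM _ b IH.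
by rewrite /chart_var eq_sym (negPf ab) eqxx.
Qed.

Lemma chart_lift F n (P : A) : F \is n.-homog -> forall e (G : S), G \is e.-homog ->
  chart F = chart G * P -> exists c (K : S), 'X_i ^+ c * F = G * K.
Proof.
move=> hF e G hG FGP; have [n0 Hn0] := chart_surj P.
have [K hK KP] := Hn0 (n0 + n)%N (leq_addr _ _).
exists (e + n0)%N, K; apply/eqP; rewrite -subr_eq0; apply/eqP.
apply: (@chart_inj _ (e + (n0 + n))%N).
  apply: rpredB; last exact: dhomogM.
  rewrite addnA; apply: dhomogM => //; exact: dhomog_mXn.
by rewrite chartB chartXiM chartM FGP KP subrr.
Qed.

End Charts.

(** * Square-freeness in a chart and division by a reduced form *)

Section Reduced.
Variable C : numClosedFieldType.
Local Notation S := {mpoly C[3]}.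
Local Notation A := {poly {poly C}}.

Lemma char0_deriv_neq0 (P : A) : (1 < size P)%N -> P^`() != 0.
Proof.
move=> P1; apply/eqP => /polyP/(_ (size P).-2).
rewrite coef_deriv coef0 => /eqP; rewrite -mulr_natr mulf_eq0.
have -> : (size P).-2.+1 = (size P).-1 by case: (size P) P1 => [|[|]].
rewrite -[P`__]/(lead_coef P) lead_coef_eq0 -size_poly_eq0.
rewrite -polyC_natr polyC_eq0 pnatr_eq0.
by case: (size P) P1 => [|[|]].
Qed.

(** In characteristic 0 coprimality with the derivative follows from square-freeness over the
    rational functions of [x_a]. A square factor there would come back to a nonconstant square
    factor of [f], by clearing denominators in [x_a], homogenizing, and removing powers of
    ['X_i]. *)
Lemma reduced_chart_coprime e (f : S) i a b : a != i -> b != i -> a != b ->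
  reduced_curve e f -> coprimep (chart a b f) (chart a b f)^`().
Proof.
move=> ai bi ab [_ hf f0 sqf]; set cf := chart a b f.
have cf0 : cf != 0 by apply: contraNneq f0 => /(chart_inj ai bi ab hf) ->.
have : separable_poly cf; last by rewrite separable_poly.unlock.
apply/separable_polyP; split; last by move=> u _; apply: char0_deriv_neq0.
apply/poly_square_freeP => u u1; apply/negP => /Pdiv.Idomain.dvdpP[[c q] /= c0 cq].
have u0 : u != 0.
  apply: contraNneq cf0 => u0; move: cq; rewrite u0 expr0n mulr0 => /eqP.
  by rewrite -mul_polyC mulf_eq0 polyC_eq0 (negPf c0).
have {u1 u0} u1 : (1 < size u)%N by rewrite ltn_neqAle eq_sym u1 size_poly_gt0.
(* Divisibility over [{poly C}] holds only up to the factor [c], a polynomial in [x_a], which splits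
   into linear primes. *)
have [c1 [xs [c10 cE]]] := closed_prod_XsubC c0.
pose ps : seq A := [seq ('X - x%:P)%:P | x <- xs].
have prm p : p \in ps -> prime_elt p by move=> /mapP[x _ ->]; apply: prime_XsubC2.
have e1 : (\prod_(p <- ps) p) * cf = u ^+ 2 * (c1^-1%:P%:P * q).
  have c1u : c1%:P%:P != 0 :> A by rewrite !polyC_eq0.
  have cq' : c%:P * cf = q * u ^+ 2 by rewrite mul_polyC.
  have cc : c1%:P%:P * c1^-1%:P%:P = 1 :> A by rewrite -!polyCM mulfV.
  apply: (mulfI c1u); rewrite mulrA -cE cq' -[q in LHS]mul1r -cc.
  by move: (c1%:P%:P : A) (c1^-1%:P%:P : A) => x y; ring.
have [m [m' [g' [b' [mm uE fE]]]]] := prime_square_descent prm e1.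
have sm : size m = 1%N.
  have pr0 : \prod_(p <- ps) p != 0 :> A.
    by apply: contraNneq c0 => p0; rewrite -polyC_eq0 cE p0 mulr0.
  have prE : \prod_(p <- ps) p = (\prod_(x <- xs) ('X - x%:P))%:P :> A.
    by rewrite /ps big_map rmorph_prod.
  have : size (\prod_(p <- ps) p) = 1%N.
    by rewrite prE size_polyC -polyC_eq0 -prE pr0.
  rewrite -mm => /eqP; rewrite -mm mulf_eq0 negb_or in pr0; case/andP: pr0 => m0 m'0.
  by rewrite size_mul_eq1 => /andP[/eqP].
have g'1 : (1 < size g')%N.
  have g'0 : g' != 0 by apply: contraTneq u1 => g0; rewrite uE g0 mulr0 size_poly0.
  move: u1; rewrite uE size_mul //; last by rewrite -size_poly_eq0 sm.
  by rewrite sm add1n.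
have [n1 /(_ (n1 + e)%N (leq_addr _ _))[G hG Gg]] := chart_surj ai bi ab g'.
have [n2 /(_ n2 (leqnn _))[H hH Hb]] := chart_surj ai bi ab b'.
have [k kE] : {k | k + e = (n1 + e) + (n1 + e) + n2}%N by exists (n1 + e + n1 + n2)%N; rewrite -!addnA [(n2 + e)%N]addnC !addnA.
have e2 : 'X_i ^+ k * f = G ^+ 2 * H.
  apply/eqP; rewrite -subr_eq0; apply/eqP; apply: (@chart_inj _ i a b ai bi ab _ (k + e)%N).
    apply: rpredB; first by apply: dhomogM => //; apply: dhomog_mXn.
    by rewrite kE expr2; apply: dhomogM => //; apply: dhomogM.
  by rewrite chartB (chartXiM ai bi) expr2 !chartM Gg Hb -/cf fE subrr.
rewrite mXn_prod in e2.
have [|mG [mG' [G' [H' [mmG GE f2]]]]] := prime_square_descent _ e2.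
  by move=> p; rewrite mem_nseq => /andP[_ /eqP ->]; apply: prime_mX.
have := sqf _ _ f2; move/msize1_polyC => G'C.
(* As a divisor of a power of ['X_i], [mG] becomes a unit in the chart, so [G] would be constant
   there. *)
have : size (chart a b mG) = 1%N.
  have := congr1 (@chart C a b) mmG.
  rewrite -mXn_prod -['X_i ^+ k]mulr1 (chartXiM ai bi) chartM [chart _ _ 1]rmorph1.
  by move=> /(congr1 (fun p : A => size p)) /eqP; rewrite size_poly1 size_mul_eq1 => /andP[/eqP].
move=> smG; move: g'1; rewrite -Gg GE chartM G'C chartC ltnNge => /negP; apply.
by rewrite mulrC mul_polyC -[leqRHS]smG; apply: size_scale_leq.
Qed.

(** The eliminating polynomial is a Bezout combination of the equation and its derivative: being
    constant in the outer variable, it involves [x_a] alone. *)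
Lemma reduced_elim_coord e (f : S) i a b : a != i -> b != i -> a != b ->
  reduced_curve e f -> elim_coord f i a b.
Proof.
move=> ai bi ab /(reduced_chart_coprime ai bi ab) /Bezout_coprimepP[[u w] /=].
rewrite -size_poly_eq1 => /size_poly1P[r r0 uw]; exists r => // T g x xi.
pose ev1 : {rmorphism {poly C} -> T} := horner_eval (x a) \o map_poly g.
pose ev : {rmorphism A -> T} := horner_eval (x b) \o map_poly ev1.
have evC c : ev c%:P = (map_poly g c).[x a].
  by rewrite /ev /= map_polyC /= horner_evalE hornerC.
have evchart F : ev (chart a b F) = mmap g x F.
  rewrite /chart (mmap_map_rmorph _ ev); congr mmap.
    by apply/funext => c; rewrite -[LHS]/(ev c%:P%:P) evC map_polyC hornerC.
  apply/funext => j; rewrite -[LHS]/(ev (chart_var C a b j)) /chart_var; case: eqP => [->|/eqP ja].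
    by rewrite evC map_polyX hornerX.
  case: eqP => [->|/eqP jb]; first by rewrite /ev /= map_polyX horner_evalE hornerX.
  by rewrite rmorph1 (ord3_index ai bi ab ja jb).
exists (ev u), (ev w); rewrite -!evchart -(chart_deriv ab) -!rmorphM -rmorphD uw evC.
done.
Qed.

(** Eliminating each coordinate in turn gives nonzero r1 in [x_a] and r2 in [x_b] whose products
    with [D] are multiples of [f]. They have no common factor, so [f] divides [D] in the chart. *)
Lemma reduced_dvd_chart e s (f D : S) i a b : a != i -> b != i -> a != b ->
  reduced_curve e f -> D \is s.-homog -> (forall j, divides f (D * f^`M(j))) ->
  exists c (K : S), 'X_i ^+ c * D = f * K.
Proof.
move=> ai bi ab red hD fD; have [_ hf f0 _] := red.
pose cf := chart a b f.
have cf0 : cf != 0 by apply: contraNneq f0 => /(chart_inj ai bi ab hf) ->.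
pose g : {rmorphism C -> A} := polyC \o polyC.
have xi : chart_var C a b i = 1 by have := chartXi C ai bi; rewrite chartX.
have ba : b != a by rewrite eq_sym.
have el a' b' : elim_coord f i a' b' -> exists2 r : {poly C}, r != 0 &
    exists p, chart a b D * (map_poly g r).[chart_var C a b a'] = cf * p.
  case=> r r0 /(_ _ g (chart_var C a b) xi)[u [w rE]]; exists r => //.
  have [q qE] := fD b'; exists (chart a b D * u + w * chart a b q).
  have := congr1 (@chart C a b) qE; rewrite !chartM => qE'.
  rewrite rE mulrDr -/(chart a b f) -/(chart a b f^`M(b')) -/cf.
  rewrite [X in _ + X]mulrCA qE' -/cf; ring.
have [r1 r10 [p pE]] := el _ _ (reduced_elim_coord ai bi ab red).
have [r2 r20 [q qE]] := el _ _ (reduced_elim_coord bi ai ba red).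
have R1 : (map_poly g r1).[chart_var C a b a] = r1%:P.
  rewrite /chart_var eqxx (map_poly_comp polyC polyC) horner_map /=.
  by rewrite -/(comp_poly 'X r1) comp_polyXr.
have R2 : (map_poly g r2).[chart_var C a b b] = map_poly polyC r2.
  rewrite /chart_var (negPf ba) eqxx (map_poly_comp polyC polyC).
  by rewrite -/(comp_poly 'X (map_poly polyC r2)) comp_polyXr.
rewrite R1 in pE; rewrite R2 in qE.
have pq : q * r1%:P = p * map_poly polyC r2.
  by apply: (mulfI cf0); rewrite !mulrA -pE -qE; ring.
have [c [xs [c0 rE]]] := closed_prod_XsubC r10.
have cu : c%:P%:P != 0 :> A by rewrite !polyC_eq0.
have : divides (\prod_(p <- [seq ('X - x%:P)%:P | x <- xs]) p) p.
  apply: (@prime_prod_cancel _ _ _ (c%:P%:P * q) (map_poly polyC r2)); last first.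
    by rewrite mulrCA mulrA -rE mulrC pq.
  move=> _ /mapP[x _ ->]; split; first exact: prime_XsubC2.
  case=> z /(congr1 (map_poly (horner_eval x))); rewrite rmorphM /= map_polyC /=.
  rewrite horner_evalE hornerXsubC subrr mul0r -map_poly_comp map_poly_id => [/eqP|y _ /=].
    exact/negP.
  by rewrite horner_evalE hornerC.
case=> p' pE'; apply: (chart_lift ai bi ab (P := c^-1%:P%:P * p') hD hf).
have r1P : r1%:P != 0 :> A by rewrite polyC_eq0.
apply: (mulIf r1P); rewrite pE pE' rE -/cf.
have cc : c%:P%:P * c^-1%:P%:P = 1 :> A by rewrite -!polyCM mulfV.
set w := \prod_(_ <- _) _.
by rewrite -[w * p']mul1r -cc; ring.
Qed.

(** The quotients in two charts have denominators that are powers of ['X_0] and of ['X_1]; these are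
    coprime, so the quotient is a polynomial. *)
Lemma reduced_dvd e s (f D : S) : reduced_curve e f -> D \is s.-homog ->
  (forall j, divides f (D * f^`M(j))) -> divides f D.
Proof.
move=> red hD fD; have [_ _ f0 _] := red.
have chart_at i : exists c (K : S), 'X_i ^+ c * D = f * K.
  by apply: (@reduced_dvd_chart e s f D i (ordS i) (ord_pred i)) => //;
    elim/ord3_ind: i; rewrite !ordS3.
have [c0 [K0 e0]] := chart_at 0; have [c1 [K1 e1]] := chart_at 1.
have eK : 'X_0 ^+ c0 * K1 = K0 * 'X_1 ^+ c1.
  by apply: (mulfI f0); rewrite mulrCA -e1 [RHS]mulrA -e0; ring.
rewrite mXn_prod in eK; have [|K Kc] := prime_prod_cancel _ eK.
  move=> p; rewrite mem_nseq => /andP[_ /eqP ->]; split; first exact: prime_mX.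
  exact: not_divides_mX.
exists K; have X0 : 'X_0 ^+ c0 != 0 :> S.
  by rewrite expf_neq0 // -msize_poly_eq0 msizeX.
by apply: (mulfI X0); rewrite e0 Kc -mXn_prod; ring.
Qed.

End Reduced.

(** * Counting intersection points *)

Local Open Scope classical_set_scope.
Local Open Scope card_scope.

Section Counting.
Variable C : numClosedFieldType.
Local Notation S := {mpoly C[3]}.

Lemma dvdp_ordge (z : C) k (p : {poly C}) :
  (('X - z%:P) ^+ k %| p) <-> ordge k (p \Po ('X + z%:P)).
Proof.
have shiftK (q : {poly C}) : (q \Po ('X + z%:P)) \Po ('X - z%:P) = q.
  by rewrite -comp_polyA comp_polyD comp_polyX comp_polyC subrK comp_polyXr.
split=> [/dvdpP[q ->]|/ordge_dvd[q e]].
  rewrite comp_polyM rmorphXn /= comp_polyB comp_polyX comp_polyC addrK.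
  exact/ordgeMl/ordgeXn.
rewrite -(shiftK p) e comp_polyM rmorphXn /= comp_polyX.
exact: dvdp_mulr.
Qed.

(** The product is the radical of [p]: at each root it supplies the one order that [G] may miss, and
    powers at distinct roots are coprime. *)
Lemma dvd_by_multiplicity (p : {poly C}) : p != 0 ->
  exists rs : seq C, [/\ uniq rs, forall z, z \in rs -> root p z & forall G,
    (forall z m, ('X - z%:P) ^+ m.+1 %| p -> ('X - z%:P) ^+ m %| G) ->
    p %| G * \prod_(z <- rs) ('X - z%:P)].
Proof.
move=> p0; have [rs pE] := closed_field_poly_normal p.
have lc0 : lead_coef p != 0 by rewrite lead_coef_eq0.
exists (undup rs); split=> [|z|G H]; first exact: undup_uniq.
  by rewrite mem_undup pE rootZ // root_prod_XsubC.
rewrite {1}pE dvdpZl // -prodr_undup_exp_count /=.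
have dvd z : z \in undup rs -> ('X - z%:P) ^+ count_mem z rs %| p.
  move=> zr; rewrite pE dvdpZr // -prodr_undup_exp_count /=.
  by rewrite (bigD1_seq z) ?undup_uniq //= dvdp_mulIl.
have : {subset undup rs <= rs} by move=> z; rewrite mem_undup.
move: (undup_uniq rs) dvd; elim: (undup rs) => [|z s IH] /=.
  by rewrite !big_nil mulr1 dvd1p.
move=> /andP[zs us] dvd sub; rewrite !big_cons Gauss_dvdp; last first.
  rewrite coprimep_expl // -[X in coprimep X]/('X - z%:P) coprimep_sym coprimep_XsubC.
  rewrite /root horner_prod prodf_seq_neq0; apply/allP => y ys /=.
  rewrite horner_exp hornerXsubC expf_neq0 // subr_eq0.
  by apply: contraNneq zs => ->.
apply/andP; split; last first.
  rewrite mulrCA; apply: dvdp_mull; apply: IH => //.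
    by move=> y ys; apply: dvd; rewrite inE ys orbT.
  by move=> y ys; apply: sub; rewrite inE ys orbT.
rewrite mulrCA mulrA mulrC; apply: dvdp_mull.
have : (0 < count_mem z rs)%N by rewrite -has_count has_pred1 sub ?mem_head.
case: (count_mem z rs) (dvd z (mem_head _ _)) => // m /H Gm _.
by rewrite exprS; apply: dvdp_mul.
Qed.

Definition point (r : 'rV[C]_3) (r0 : r != 0) : P2 C :=
  exist _ <[r]>%VS (introT eqP (etrans (dim_vline r) (congr1 nat_of_bool r0))).

Lemma vanishes_at_point s (g : S) (r : 'rV[C]_3) (r0 : r != 0) : g \is s.-homog ->
  g.@[r 0] = 0 -> vanishes_at g (point r0).
Proof.
move=> hg gr v /vlineP[k ->].
have := mmap_homog_scale idfun k (r 0) hg; rewrite [X in _ = _ * X]gr mulr0 => <-.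
by apply: (mmap_eq idfun) => j; rewrite mxE.
Qed.

Lemma meval_horner (P : 'I_3 -> {poly C}) (F : S) z :
  (mmap polyC P F).[z] = F.@[fun j => (P j).[z]].
Proof.
rewrite -[LHS]/(horner_eval z (mmap polyC P F)) (mmap_map_rmorph _ (horner_eval z)).
by rewrite /meval; congr mmap; apply/funext => c /=; rewrite horner_evalE hornerC.
Qed.

Variables (P : 'I_3 -> {poly C}) (f l : S) (e D : nat).

(** A projectively injective immersion of the affine line into the smooth points of [l = 0]. The
    scalar [x] in the injectivity clause may be 0, which forces [P] to vanish nowhere. *)
Definition curve_param := [/\ mmap polyC P l = 0,
  forall z, exists j, (l^`M(j)).@[fun j => (P j).[z]] != 0,
  forall z y x, (forall j, (P j).[z] = x * (P j).[y]) -> z = y,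
  forall z x, ~ (forall j, (P j)^`().[z] = x * (P j).[z]) &
  forall j, (size (P j) <= D.+1)%N].

Variable param : curve_param.

Let row z : 'rV[C]_3 := \row_j (P j).[z].

Lemma param_row_neq0 z : row z != 0.
Proof.
have [_ _ inj _ _] := param; apply/eqP => /rowP r0.
suff : z = z + 1 by move/eqP; rewrite -subr_eq0 opprD addNKr oppr_eq0 oner_eq0.
by apply: (inj _ _ 0) => j; have := r0 j; rewrite !mxE mul0r.
Qed.

Lemma size_param s (F : S) : F \is s.-homog -> (size (mmap polyC P F) <= (D * s).+1)%N.
Proof.
have [_ _ _ _ szP] := param => hF; rewrite /mmap big_seq.
apply: (leq_trans (size_sum _ _ _)); apply/bigmax_leqP_seq => m mF _.
rewrite mul_polyC (leq_trans (size_scale_leq _ _)) //.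
have ms : mdeg m = s := dhomogP _ _ _ hF m mF.
rewrite -ms mdegE /mmap1.
apply: (big_ind2 (fun (p : {poly C}) k => size p <= (D * k).+1)%N).
- by rewrite size_poly1.
- move=> p k q k' pk qk; apply: leq_trans (size_polyMleq _ _) _.
  by rewrite mulnDr -ltnS; case: (size p + size q)%N (leq_add pk qk) => //= n; rewrite addnS addSn.
move=> j _; apply: leq_trans (size_poly_exp_leq _ _) _.
by rewrite ltnS leq_mul2r -subn1 leq_subLR add1n szP orbT.
Qed.

Hypotheses (hl : l \is D.-homog) (hf : f \is e.-homog).

Lemma param_point z : root (mmap polyC P f) z ->
  vanishes_at f (point (param_row_neq0 z)) /\ vanishes_at l (point (param_row_neq0 z)).
Proof.
have [lP _ _ _ _] := param => fz.
have rowE (F : S) : F.@[row z 0] = (mmap polyC P F).[z].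
  by rewrite meval_horner; apply: meval_eq => j; rewrite mxE.
split; first by apply: (vanishes_at_point hf); rewrite rowE; apply/eqP.
by apply: (vanishes_at_point hl); rewrite rowE lP horner0.
Qed.

Lemma points_card (rs : seq C) n : uniq rs ->
  (forall z, z \in rs -> root (mmap polyC P f) z) -> (n <= size rs)%N ->
  `I_n #<= curve_points f `&` curve_points l.
Proof.
move=> urs rsf n_rs.
pose h k := point (param_row_neq0 (nth 0 rs k)).
have hinj : {in `I_n &, injective h}.
  move=> k k'; rewrite !inE => /= kn k'n /(congr1 val) /= hh.
  have : row rs`_k \in <[row (rs`_k')%R]>%VS by rewrite -hh memv_line.
  case/vlineP => x /rowP xE; have [_ _ inj _ _] := param.
  have : nth 0 rs k = nth 0 rs k'.
    by apply: (inj _ _ x) => j; have := xE j; rewrite !mxE.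
  by move/eqP; rewrite (nth_uniq 0 (leq_trans kn n_rs) (leq_trans k'n n_rs) urs) => /eqP.
rewrite -(card_le_eql (inj_card_eq hinj)); apply: subset_card_le => _ [k /= kn <-].
by apply: param_point; apply: rsf; rewrite mem_nth // (leq_trans kn).
Qed.

Hypotheses (red : reduced_curve e f)
  (qh : only_quasihomog_sing (f * l)) (fP : mmap polyC P f != 0).

Lemma syzygy_multiplicity (delta : 'I_3 -> S) s z m :
  \sum_j delta j * f^`M(j) = 0 -> \sum_j delta j * l^`M(j) \is s.-homog ->
  ('X - z%:P) ^+ m.+1 %| mmap polyC P f ->
  ('X - z%:P) ^+ m %| mmap polyC P (\sum_j delta j * l^`M(j)).
Proof.
move=> df hdl fm; have [lP lreg _ immersed _] := param.
have [k [q]] := multiplicity_XsubC (mmap polyC P f) z; rewrite fP /= => qz fE.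
have mk : (m < k)%N.
  rewrite ltnNge; apply: contraNN qz => km; move: fm.
  rewrite fE -(subnK (leqW km)) exprD dvdp_mul2r ?expf_neq0 ?polyXsubC_eq0 //.
  by rewrite subSn // exprS => /(dvdp_trans (dvdp_mulr _ (dvdpp _))); rewrite dvdp_XsubCl.
apply: dvdp_trans (dvdp_exp2l _ (_ : m <= k.-1)%N) _; first by rewrite -ltnS prednK // (leq_trans _ mk).
have fz : root (mmap polyC P f) z.
  by rewrite fE rootM -(prednK (leq_ltn_trans (leq0n m) mk)) root_exp_XsubC eqxx orbT.
have [fp lp] := param_point fz.
have [i [v [vp vi germ]]] : quasihomog_at (f * l) (point (param_row_neq0 z)).
  apply: qh; split=> [w wp|j w wp]; first by rewrite mevalM (fp w wp) mul0r.
  by rewrite mderivM mevalD !mevalM (fp w wp) (lp w wp) mulr0 mul0r addr0.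
have [y vE] := vlineP _ _ vp.
have y0 : y != 0.
  by apply: contra_eq_neq vi => y0; rewrite vE y0 scale0r mxE eq_sym oner_eq0.
have vj j : v 0 j = y * (P j).[z] by rewrite vE !mxE.
pose Q j := P j \Po ('X + z%:P).
have Qcomp F : mmap polyC Q F = mmap polyC P F \Po ('X + z%:P).
  rewrite (mmap_map_rmorph _ (comp_poly ('X + z%:P))); congr mmap.
  by apply/funext => c /=; rewrite comp_polyC.
apply/dvdp_ordge; rewrite -Qcomp.
apply: (local_tangency (c := y^-1) (v := v 0) (s := s) hf hl vi _ germ) => //.
- by rewrite invr_eq0.
- by move=> a b ai bi ab; apply: reduced_elim_coord red.
- by move=> j; rewrite vj mulKf // /Q -horner_coef0 horner_comp !hornerE.
- case=> x Hx; apply: (immersed z (x * y)) => j.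
  have := Hx j; rewrite vj mulrA => <-.
  have -> : (Q j)`_1 = ((Q j)^`())`_0 by rewrite coef_deriv mulr1n.
  rewrite /Q deriv_comp derivD derivX derivC addr0 mulr1 -horner_coef0 horner_comp.
  by rewrite !hornerE.
- by rewrite Qcomp lP comp_poly0.
- have [j lj] := lreg z; exists j.
  rewrite (meval_eq (v2 := fun j => y * (P j).[z])); last exact: vj.
  rewrite /meval (mmap_homog_scale idfun _ _ (mderiv_dhomog j hl)) mulf_neq0 //.
  exact: expf_neq0.
- by rewrite Qcomp; apply/dvdp_ordge; rewrite fE dvdp_mulIr.
rewrite Qcomp => /dvdp_ordge; rewrite fE exprS dvdp_mul2r ?dvdp_XsubCl ?(negPf qz) //.
by rewrite expf_neq0 // polyXsubC_eq0.
Qed.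

(** [R] is the radical of [f(P)]. Distinct roots give distinct intersection points, so there are at
    most n - 1 of them and the size of [R], its degree plus one, is at most n. *)
Lemma few_points_dvd n :
  ~ (`I_n #<= curve_points f `&` curve_points l) ->
  exists R : {poly C}, [/\ R != 0, (size R <= n)%N & forall d v, AR_deg f d v ->
    mmap polyC P f %| mmap polyC P (\sum_j v 0 j * l^`M(j)) * R].
Proof.
move=> few; have [rs [urs rsf dvd]] := dvd_by_multiplicity fP.
exists (\prod_(z <- rs) ('X - z%:P)); split; last 1 first.
- move=> d v [vf vh]; apply: dvd => z m.
  apply: (syzygy_multiplicity (s := (d + D.-1)%N) vf).
  by apply: rpred_sum => j _; apply: dhomogM => //; apply: mderiv_dhomog.
- by rewrite monic_neq0 // monic_prod // => z _; apply: monicXsubC.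
by rewrite size_prod_XsubC ltnNge; apply/negP => /(points_card urs rsf).
Qed.

End Counting.

(** * Lines *)

Section Params.
Variable C : numClosedFieldType.
Local Notation S := {mpoly C[3]}.

Lemma natr_mpoly_neq0 e : (0 < e)%N -> (e%:R : S) != 0.
Proof. by move=> e0; rewrite -mpolyC_nat mpolyC_eq0 pnatr_eq0 -lt0n. Qed.

(** The coefficients of degree D of [P] form its point at infinity, and the top coefficient of
    [F(P)] is the value of [F] at that point. *)
Lemma coef_param (P : 'I_3 -> {poly C}) D s (F : S) :
  (forall j, (size (P j) <= D.+1)%N) -> F \is s.-homog ->
  (mmap polyC P F)`_(D * s) = F.@[fun j => (P j)`_D].
Proof.
move=> szP hF; rewrite /meval /mmap coef_sum; apply: eq_big_seq => m mF.
have ms : mdeg m = s := dhomogP _ _ _ hF m mF.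
rewrite coefCM; congr (_ * _).
have lead (p q : {poly C}) k k' : (size p <= k.+1)%N -> (size q <= k'.+1)%N ->
    (size (p * q)%R <= (k + k').+1)%N /\ (p * q)`_(k + k') = p`_k * q`_k'.
  move=> pk qk; split.
    apply: leq_trans (size_polyMleq _ _) _; move: (leq_add pk qk).
    by case: (size p + size q)%N => //= n; rewrite addnS addSn.
  rewrite coefM (bigD1 (Ordinal (leq_addr k' k : (k < (k + k').+1)%N))) //=.
  rewrite addKn big1 ?addr0 // => j; rewrite -val_eqE /= => jk.
  have [kj|jlt] := ltnP k j; first by rewrite [p`_j]nth_default ?mul0r // (leq_trans pk).
  rewrite [q`__]nth_default ?mulr0 // (leq_trans qk) //.
  by rewrite ltn_subRL ltn_add2r ltn_neqAle jk.
have [] : (size (mmap1 P m) <= (D * mdeg m).+1)%N /\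
    (mmap1 P m)`_(D * mdeg m) = mmap1 (fun j => (P j)`_D) m; last by rewrite ms.
rewrite mdegE /mmap1.
apply: (big_ind3 (fun (k : nat) (p : {poly C}) (c : C) =>
  (size p <= (D * k).+1)%N /\ p`_(D * k) = c)).
- by rewrite muln0 size_poly1 coefC.
- by move=> k p c k' q c' [pk <-] [qk <-]; rewrite mulnDr; apply: lead.
move=> j _; elim: (m j) => [|k [sk ck]]; first by rewrite muln0 !expr0 size_poly1 coefC.
by rewrite exprS mulnS exprS -ck; apply: lead.
Qed.

(** Two linear functionals, equal to 1 and to a nonzero multiple of the parameter along the curve,
    recover the parameter; this gives injectivity and immersion. *)
Lemma functional_param (P : 'I_3 -> {poly C}) (l : S) D (al de : 'I_3 -> C) k :
  mmap polyC P l = 0 ->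
  (forall z, exists j, (l^`M(j)).@[fun j => (P j).[z]] != 0) ->
  (forall j, (size (P j) <= D.+1)%N) -> k != 0 ->
  \sum_j (al j)%:P * P j = 1 -> \sum_j (de j)%:P * P j = k *: 'X ->
  curve_param P l D.
Proof.
move=> lP lreg szP k0 alP deP; split=> //.
- move=> z y x e; have ev (g : 'I_3 -> C) (Q : {poly C}) : \sum_j (g j)%:P * P j = Q ->
      Q.[z] = x * Q.[y].
    move=> <-; rewrite !horner_sum mulr_sumr; apply: eq_bigr => j _.
    by rewrite !hornerM !hornerC e mulrCA.
  have := ev _ _ alP; have := ev _ _ deP.
  rewrite !hornerZ !hornerX !hornerC mulr1 => + x1; rewrite -x1 mul1r.
  exact: mulfI.
move=> z x e; have ev (g : 'I_3 -> C) (Q : {poly C}) : \sum_j (g j)%:P * P j = Q ->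
    (Q^`()).[z] = x * Q.[z].
  move=> <-; rewrite raddf_sum !horner_sum mulr_sumr; apply: eq_bigr => j _.
  by rewrite /= derivM derivC mul0r add0r !hornerM !hornerC e mulrCA.
have := ev _ _ alP; rewrite -polyC1 derivC !hornerC mulr1 => x0.
have := ev _ _ deP; rewrite -x0 mul0r derivZ derivX hornerZ hornerC mulr1 => /eqP.
exact/negP.
Qed.

Lemma infinite_points (P : 'I_3 -> {poly C}) (f l : S) e D n :
  curve_param P l D -> l \is D.-homog -> f \is e.-homog -> mmap polyC P f = 0 ->
  `I_n #<= curve_points f `&` curve_points l.
Proof.
move=> param hl hf fP; apply: (points_card param hl hf (rs := [seq k%:R | k <- iota 0 n])).
- by rewrite map_inj_uniq ?iota_uniq // => x y /eqP; rewrite eqr_nat => /eqP.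
- by move=> z _; rewrite fP root0.
by rewrite size_map size_iota.
Qed.

(* Mixed Koszul syzygies show that the gradients of f and l cannot stay
   proportional along the curve, by Euler's identity for both. *)
Lemma koszul_restriction (P : 'I_3 -> {poly C}) (f l : S) e D :
  (0 < e)%N -> f \is e.-homog -> l \is D.-homog ->
  mmap polyC P l = 0 -> (exists j, mmap polyC P l^`M(j) != 0) ->
  (forall v, AR f v -> mmap polyC P (\sum_j v 0 j * l^`M(j)) = 0) ->
  mmap polyC P f = 0.
Proof.
move=> e0 hf hl lP [i li] H.
have prop j : mmap polyC P f^`M(j) * mmap polyC P l^`M(i) =
              mmap polyC P f^`M(i) * mmap polyC P l^`M(j).
  pose v : 'rV[S]_3 := \row_k (f^`M(j) * (k == i)%:R - f^`M(i) * (k == j)%:R).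
  have vE (F : S) : \sum_k v 0 k * F^`M(k) = f^`M(j) * F^`M(i) - f^`M(i) * F^`M(j).
    under eq_bigr => k _ do rewrite mxE mulrBl -!mulrA ![_%:R * _]mulrC.
    rewrite sumrB -!mulr_sumr; congr (_ * _ - _ * _); exact: sum_delta.
  have /H : AR f v by rewrite /AR vE mulrC subrr.
  by rewrite vE mmapB !rmorphM => /subr0_eq.
have eul := congr1 (mmap polyC P) (euler_mderiv hf).
have eulP F d : F \is d.-homog ->
    \sum_j P j * mmap polyC P F^`M(j) = d%:R * mmap polyC P F.
  move=> hF; have := congr1 (mmap polyC P) (euler_mderiv hF).
  rewrite raddf_sum rmorphM rmorph_nat /= => <-.
  by apply: eq_bigr => j _; rewrite rmorphM /= mmapXU.
have : (e%:R * mmap polyC P f) * mmap polyC P l^`M(i) = 0.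
  rewrite -(eulP _ _ hf) mulr_suml.
  under eq_bigr => j _ do rewrite -mulrA prop mulrCA.
  by rewrite -mulr_sumr (eulP _ _ hl) lP !mulr0.
move=> /eqP; rewrite !mulf_eq0 (negPf li) orbF -polyC_natr polyC_eq0 pnatr_eq0.
by rewrite eqn0Ngt e0 => /eqP.
Qed.

Lemma min_gens_neq0 (g : S) m (d : m.-tuple nat) v j : AR_min_gens g d v -> v j != 0.
Proof.
case=> _ _ gen /(_ j) min; apply/eqP => vj; apply: min => w /gen[c ->].
by exists c; rewrite (bigD1 j) //= vj scaler0 add0r.
Qed.

Lemma pihomogM k e (p q : S) : q \is e.-homog ->
  pihomog mdeg k (p * q) = if (e <= k)%N then pihomog mdeg (k - e) p * q else 0.
Proof.
move=> hq; have hqE : homogenize q = q *: 'X^e.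
  apply/polyP => i; rewrite coef_homogenize coefZ coefXn.
  case: eqP => [->|/eqP ie]; first by rewrite mulr1 pihomog_dE.
  by rewrite mulr0 (pihomog_ne0 _ hq) // eq_sym.
rewrite -coef_homogenize homogenizeM hqE -scalerAr coefZ coefMXn ltnNge.
by case: leqP => _ /=; rewrite ?mulr0 // coef_homogenize mulrC.
Qed.

Lemma min_gens_low_degree (g : S) m (d : m.-tuple nat) v t w :
  AR_min_gens g d v -> (forall i, t < tnth d i)%N -> AR_deg g t w -> w = 0.
Proof.
case=> _ hom gen _ td [/gen[c cE] hw]; apply/rowP => j; rewrite mxE.
rewrite -(pihomog_dE (hw j)) cE summxE raddf_sum big1 // => i _ /=.
by rewrite mxE (pihomogM _ _ (proj2 (hom i) j)) leqNgt td.
Qed.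

Lemma linear_mmap (l : S) (T : comNzRingType) (g : {rmorphism C -> T}) x :
  l \is 1.-homog -> mmap g x l = \sum_j g l@_U_(j) * x j.
Proof.
move=> hl; rewrite [in LHS](dhomog1_sum hl) raddf_sum; apply: eq_bigr => j _.
by rewrite /= mmapZ mmapXU.
Qed.

Lemma mderiv_linear (l : S) j : l \is 1.-homog -> l^`M(j) = (l@_U_(j))%:MP.
Proof.
move=> hl; apply/mpolyP => m; rewrite mcoeff_deriv mcoeffC.
have [<-|m0] := eqVneq 0%MM m; first by rewrite add0m mnm0E mulr1n mulr1.
have deg : mdeg (m + U_(j))%MM != 1%N by rewrite mdegD mdeg1 addn1 eqSS mdeg_eq0 eq_sym.
by rewrite (dhomog_nemf_coeff hl deg) mul0rn mulr0.
Qed.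

Lemma line_param (l : S) (b : 'I_3 -> C) : is_line l -> l.@[b] = 0 ->
  (exists j, b j != 0) ->
  exists2 P : 'I_3 -> {poly C}, curve_param P l 1 & forall j, (P j)`_1 = b j.
Proof.
case=> hl l0 lb [j0 bj0]; pose c j := l@_U_(j).
have [i ci] : exists i, c i != 0.
  apply: contrapT => /forallNP H; case/negP: l0.
  rewrite (dhomog1_sum hl) big1 // => j _.
  by have /negP := H j; rewrite negbK => /eqP; rewrite /c => ->; rewrite scale0r.
have two (V : zmodType) (h : 'I_3 -> V) : \sum_j h j = h i + (h (ordS i) + h (ord_pred i)).
  rewrite sum3; elim/ord3_ind: (i); rewrite !ordS3; first by rewrite addrA.
    by rewrite -addrA addrC addrA.
  by rewrite addrC.
have lbE : c i * b i + (c (ordS i) * b (ordS i) + c (ord_pred i) * b (ord_pred i)) = 0.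
  by rewrite -[RHS]lb /meval (linear_mmap _ _ hl) two.
have [j [k [bj ji ki jk sumE]]] : exists j k, [/\ b j != 0, j != i, k != i, j != k &
    forall (V : zmodType) (h : 'I_3 -> V), \sum_j h j = h i + (h j + h k)].
  have S1 : ordS i != i by elim/ord3_ind: (i); rewrite !ordS3.
  have S2 : ord_pred i != i by elim/ord3_ind: (i); rewrite !ordS3.
  have S3 : ordS i != ord_pred i by elim/ord3_ind: (i); rewrite !ordS3.
  have [b1|b1] := eqVneq (b (ordS i)) 0; last by exists (ordS i), (ord_pred i).
  exists (ord_pred i), (ordS i); split=> //; [|by rewrite eq_sym|].
    apply: contraNneq bj0 => b2; move: lbE; rewrite b1 b2 !mulr0 !addr0 => /eqP.
    rewrite mulf_eq0 (negPf ci) /= => bi.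
    have [->//|ne] := eqVneq j0 i; have [->|ne'] := eqVneq j0 (ordS i); first by rewrite b1.
    have [->|ne2] := eqVneq j0 (ord_pred i); first by rewrite b2.
    by rewrite (ord3_index S1 S2 S3 ne' ne2).
  by move=> V h; rewrite two [h (ordS i) + _]addrC.
have {}lbE : c i * b i + (c j * b j + c k * b k) = 0.
  by rewrite -[RHS]lb /meval (linear_mmap _ _ hl) sumE.
(* A second point of the line: its j-th coordinate is 0 where that of [b] is not, and its i-th
   coordinate solves the equation of the line. *)
pose a j' := if j' == i then - (c k / c i) else (j' == k)%:R.
have [ai aj ak] : [/\ a i = - (c k / c i), a j = 0 & a k = 1].
  by rewrite /a eqxx (negPf ji) (negPf ki) (negPf jk) eqxx.
have la : c i * a i + (c j * a j + c k * a k) = 0.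
  by rewrite ai aj ak mulr0 add0r mulr1 mulrN mulrC divfK // addNr.
pose P j' : {poly C} := (a j')%:P + b j' *: 'X.
exists P; last by move=> j'; rewrite /P coefD coefC coefZ coefX add0r mulr1.
have fn (g : 'I_3 -> C) : \sum_j' (g j')%:P * P j' =
   (g i * a i + (g j * a j + g k * a k))%:P + (g i * b i + (g j * b j + g k * b k)) *: 'X.
  by rewrite sumE /P -!mul_polyC !polyCD !polyCM; ring.
(* The first functional kills [b] and is 1 at [a]; the second kills [a] and is [b j] at [b]. *)
apply: (@functional_param P l 1
    (fun j' => if j' == i then 0 else if j' == k then 1 else - (b k / b j))
    (fun j' => (j' == j)%:R) (b j)) => //.
- by rewrite (linear_mmap _ _ hl) fn -/(c i) -/(c j) -/(c k) la lbE scale0r addr0.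
- by move=> z; exists i; rewrite (mderiv_linear _ hl) mevalC.
- move=> j'; apply: leq_trans (size_polyD _ _) _; rewrite geq_max size_polyC.
  rewrite (leq_trans (leq_b1 _)) //=.
  by apply: leq_trans (size_scale_leq _ _) _; rewrite size_polyX.
- rewrite fn eqxx (negPf ji) (negPf ki) (negPf jk) eqxx !mul0r !add0r aj ak.
  by rewrite mulr0 add0r !mul1r mulNr divfK // addNr scale0r addr0.
rewrite fn eqxx [i == j]eq_sym [k == j]eq_sym (negPf ji) (negPf jk) aj.
by rewrite !mul0r !mul1r !add0r !addr0.
Qed.

Lemma size_mmap_param (P : 'I_3 -> {poly C}) (f l : S) e D :
  curve_param P l D -> f \is e.-homog -> f.@[fun j => (P j)`_D] != 0 ->
  size (mmap polyC P f) = (D * e).+1.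
Proof.
move=> param hf fb; have [_ _ _ _ szP] := param.
apply/eqP; rewrite eqn_leq (size_param param hf) /= ltnNge; apply: contraNN fb => sz.
by rewrite -(coef_param szP hf) nth_default.
Qed.

Lemma dvd_size_lt (p G R : {poly C}) : R != 0 ->
  p %| G * R -> (size G + size R <= size p)%N -> G = 0.
Proof.
move=> R0 pGR sz; apply/eqP; apply: contraTT pGR => G0; apply: contraL sz => pGR.
rewrite -ltnNge; have := dvdp_leq (mulf_neq0 G0 R0) pGR; rewrite size_mul //.
have : (0 < size G)%N by rewrite size_poly_gt0.
by case: (size G) => // n _; rewrite addSn ltnS.
Qed.

Lemma nearly_free_line (f l : S) : nearly_free f -> is_line l ->
  only_quasihomog_sing (f * l) -> `I_(mdr f) #<= curve_points f `&` curve_points l.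
Proof.
case=> e [d1 [d2 [d3 [v [red gens d12 d32]]]]] line qh; subst d3.
have [hl l0] := line; have [e0 hf f0 _] := red.
(* A point of the line off the curve is sent to infinity, so that [f(P)] has degree e. If there is
   none, the line lies in the curve and there are infinitely many common points. *)
have [[b [lb b0 fb]]|/forallNP onl] := pselect (exists b : 'I_3 -> C,
    [/\ l.@[b] = 0, exists j, b j != 0 & f.@[b] != 0]); last first.
  have [b [lb b0]] : exists b : 'I_3 -> C, l.@[b] = 0 /\ exists j, b j != 0.
    pose c j := l@_U_(j); have lE b : l.@[b] = \sum_j c j * b j.
      by rewrite /meval (linear_mmap _ _ hl).
    have [c0|c0] := eqVneq (c 0) 0.
      exists (fun j => (j == 0)%:R); split; last by exists 0; rewrite eqxx oner_eq0.
      by rewrite lE sum_delta.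
    exists (fun j => (j == 0)%:R * c 1 - (j == 1)%:R * c 0); split.
      rewrite lE; under eq_bigr => j _ do rewrite mulrBr !mulrA.
      by rewrite sumrB -!mulr_suml !sum_delta mulrC subrr.
    by exists 1; rewrite eqxx mul1r mul0r sub0r oppr_eq0.
  have [P param _] := line_param line lb b0; apply: (infinite_points _ param hl hf).
  have [lP _ inj _ _] := param.
  apply/eqP; apply/negPn/negP => fP; have [z fz] := closed_nonrootP _ fP.
  case: (onl (fun j => (P j).[z])); split.
  - by rewrite -meval_horner lP horner0.
  - apply: contrapT => /forallNP Pz; have : z = z + 1.
      by apply: (inj _ _ 0) => j; have /negP := Pz j; rewrite negbK mul0r => /eqP.
    by move/eqP; rewrite -subr_eq0 opprD addNKr oppr_eq0 oner_eq0.
  by rewrite -meval_horner.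
have [P param Pb] := line_param line lb b0; have [lP lreg _ _ _] := param.
apply: contrapT => few.
have fPsz : size (mmap polyC P f) = (1 * e).+1.
  by apply: (size_mmap_param param hf); rewrite (meval_eq (v2 := b)).
have fP0 : mmap polyC P f != 0 by rewrite -size_poly_eq0 fPsz.
have [R [R0 szR dvd]] := few_points_dvd param hl hf red qh fP0 few.
have md : (mdr f <= d1)%N.
  apply: (proj2 (mdrP hf)); exists (v ord0); last exact: min_gens_neq0 gens.
  by have [_ /(_ ord0)] := gens.
have [srt hom gen _] := gens.
have d12' : (d1 <= d2)%N by move: srt => /= /andP[].
have Gi i : mmap polyC P (\sum_j v i 0 j * l^`M(j)) = 0.
  have di : (tnth [tuple d1; d2; d2] i <= d2)%N.
    by elim/ord3_ind: i; rewrite (tnth_nth 0%N).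
  apply: (dvd_size_lt R0 (dvd _ _ (hom i))); rewrite fPsz mul1n.
  have hG : \sum_j v i 0 j * l^`M(j) \is (tnth [tuple d1; d2; d2] i + 0).-homog.
    apply: rpred_sum => j _; apply: dhomogM; first by have [_] := hom i.
    exact: (mderiv_dhomog j hl).
  apply: leq_trans (leq_add (size_param param hG) (leq_trans szR md)) _.
  by rewrite mul1n addn0 addSn ltnS -d12 addnC leq_add2l.
case/negP: fP0; apply/eqP; apply: (koszul_restriction e0 hf hl lP).
  have [j lj] := lreg 0; exists j; apply: contraNneq lj => e'.
  by rewrite -meval_horner e' horner0.
move=> w /gen[cw ->]; pose G (w : 'rV[S]_3) := \sum_j w 0 j * l^`M(j).
have -> : \sum_j (\sum_(i | predT i) cw i *: v i) 0 j * l^`M(j) =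
    \sum_i cw i * \sum_j v i 0 j * l^`M(j).
  under [RHS]eq_bigr => i _ do rewrite mulr_sumr.
  rewrite exchange_big; apply: eq_bigr => j _; rewrite summxE mulr_suml.
  by apply: eq_bigr => i _; rewrite mxE mulrA.
by rewrite raddf_sum big1 // => i _; rewrite /= rmorphM /= Gi mulr0.
Qed.

End Params.

(** * Conics *)

Section CrossHomog.
Variable C : numClosedFieldType.
Local Notation S := {mpoly C[3]}.

Lemma dhomog_cross3 (u w : 'I_3 -> S) d d' j : (forall j, u j \is d.-homog) ->
  (forall j, w j \is d'.-homog) -> cross3 u w j \is (d + d').-homog.
Proof. by move=> hu hw; apply: rpredB; apply: dhomogM. Qed.

Lemma dhomog_dot3 (u w : 'I_3 -> S) d d' : (forall j, u j \is d.-homog) ->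
  (forall j, w j \is d'.-homog) -> dot3 u w \is (d + d').-homog.
Proof. by move=> hu hw; apply: rpred_sum => j _; apply: dhomogM. Qed.

(** Cramer's rule and Euler's identity show that the determinant times each partial derivative of
    [f] is a multiple of [f]; reducedness then gives divisibility of the determinant, and its degree
    e + 1 leaves a linear quotient. *)
Lemma det3_syzygies (f : S) e d1 d2 (u w : 'I_3 -> S) :
  reduced_curve e f -> (d1 + d2 = e)%N ->
  (forall j, u j \is d1.-homog) -> (forall j, w j \is d2.-homog) ->
  \sum_j u j * f^`M(j) = 0 -> \sum_j w j * f^`M(j) = 0 ->
  exists g : S, [/\ g \is 1.-homog, det3 u w (fun j => 'X_j) = f * g &
    forall j, e%:R * cross3 u w j = g * f^`M(j)].
Proof.
move=> red d12 hu hw uf wf; have [e0 hf f0 _] := red.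
pose X j : S := 'X_j; pose De := det3 u w X.
have hX j : X j \is 1.-homog by apply: dhomog_mX.
have hDe : De \is (e + 1).-homog.
  rewrite -d12 -addnA; apply: dhomog_dot3 => // j; exact: dhomog_cross3.
have dotC (a b : 'I_3 -> S) : dot3 a b = \sum_j b j * a j.
  by apply: eq_bigr => j _; rewrite mulrC.
have De_f j : De * f^`M(j) = e%:R * f * cross3 u w j.
  have := cramer3 u w X (fun j => f^`M(j)) j.
  by rewrite !dotC uf wf (euler_mderiv hf) !mul0r !add0r.
have [g Dg] : divides f De.
  apply: (reduced_dvd red hDe) => j; exists (e%:R * cross3 u w j).
  by rewrite De_f -mulrA mulrCA.
have DgE : De = f * pihomog mdeg 1 g.
  rewrite -(pihomog_dE hDe) Dg mulrC (pihomogM _ _ hf) leq_addr addKn.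
  by rewrite mulrC.
exists (pihomog mdeg 1 g); split=> // [|j]; first exact: pihomogP.
apply: (mulfI f0); rewrite [RHS]mulrA -DgE De_f; ring.
Qed.

(* If [u] and [w] are parallel, every Koszul syzygy wedged with [u] is a multiple
   of [u x r]; comparing with [u x (e_k x grad f) = - u_k grad f] forces [u] to be
   divisible by a linear form, against the minimality of its degree. *)
Lemma parallel_generators_contra (f : S) e d1 d2 (u w r : 'rV[S]_3) :
  reduced_curve e f -> (d1 + d2 = e)%N ->
  AR_deg f d1 u -> AR_deg f d2 w -> AR_deg f d2 r -> u != 0 ->
  (forall x, AR f x -> exists a b c, x = a *: u + b *: w + c *: r) ->
  (forall t x, (t < d1)%N -> AR_deg f t x -> x = 0) ->
  (forall j, cross3 (u 0) (w 0) j = 0) -> False.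
Proof.
move=> red d12 [uf hu] _ [rf hr] u0 gen low uw; have [e0 hf f0 _] := red.
have [g [hg _ ur]] := det3_syzygies red d12 hu hr uf rf.
have eS := natr_mpoly_neq0 C e0.
have [j0 fj0] : exists j, f^`M(j) != 0.
  apply: contrapT => /forallNP H; case/negP: (mulf_neq0 eS f0).
  rewrite -(euler_mderiv hf) big1 // => j _.
  by have /negP := H j; rewrite negbK => /eqP ->; rewrite mulr0.
have uk k : exists c, e%:R * u 0 k = g * c.
  pose kap : 'rV[S]_3 := \row_j cross3 (fun j => (j == k)%:R) (fun j => f^`M(j)) j.
  have kf : AR f kap.
    rewrite /AR; under eq_bigr => j _ do rewrite mxE.
    by rewrite sum3 /cross3 !ordS3; ring.
  have [a [b [c kE]]] := gen kap kf; exists (- c).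
  have crossE : cross3 (u 0) (kap 0) j0 = c * cross3 (u 0) (r 0) j0.
    have -> : cross3 (u 0) (kap 0) j0 = a * cross3 (u 0) (u 0) j0 +
        b * cross3 (u 0) (w 0) j0 + c * cross3 (u 0) (r 0) j0.
      by rewrite /cross3 kE !mxE; ring.
    by rewrite uw mulr0 addr0 /cross3 [X in X - _]mulrC subrr mulr0 add0r.
  have kap_u : cross3 (u 0) (kap 0) j0 = - u 0 k * f^`M(j0).
    rewrite [in RHS](_ : - u 0 k * f^`M(j0) = (j0 == k)%:R * (\sum_j u 0 j * f^`M(j))
      - u 0 k * f^`M(j0)); last by rewrite uf mulr0 sub0r mulNr.
    have kapE j : kap 0 j = cross3 (fun j => (j == k)%:R) (fun j => f^`M(j)) j by rewrite mxE.
    rewrite /cross3 !kapE /cross3 sum3.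
    have -> : u 0 k = \sum_j u 0 j * (j == k)%:R by rewrite sum_delta.
    rewrite sum3.
    by elim/ord3_ind: (j0); rewrite !ordS3; ring.
  apply: (mulIf fj0).
  have : e%:R * cross3 (u 0) (kap 0) j0 = c * (g * f^`M(j0)) by rewrite crossE -ur; ring.
  rewrite kap_u => H; rewrite -[LHS]opprK -[RHS]opprK; congr (- _).
  by rewrite mulrN mulNr opprK -mulrA [g * _]mulrC -mulrA -H; ring.
have [s sE] : exists s : 'I_3 -> S, forall k, u 0 k = g * s k.
  have /choice[c cE] := uk; exists (fun k => (e%:R^-1)%:MP * c k) => k.
  apply: (mulfI eS); rewrite cE mulrCA; congr (_ * _).
  by rewrite mulrA -mpolyC_nat -mpolyCM divff ?mpolyC1 ?mul1r // pnatr_eq0 -lt0n.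
have g0 : g != 0.
  by apply: contraNneq u0 => g0; apply/eqP/rowP => k; rewrite mxE sE g0 mul0r.
have uE k : u 0 k = if (1 <= d1)%N then pihomog mdeg (d1 - 1) (s k) * g else 0.
  by rewrite -(pihomogM _ _ hg) [_ * g]mulrC -sE pihomog_dE.
have d1gt : (0 < d1)%N.
  rewrite ltnNge; apply: contraNN u0 => d10; apply/eqP/rowP => k.
  by rewrite mxE uE leqNgt ltnS d10.
pose s' : 'rV[S]_3 := \row_k pihomog mdeg (d1 - 1) (s k).
have us k : u 0 k = s' 0 k * g by rewrite uE d1gt mxE.
have : s' = 0.
  apply: (low (d1 - 1)%N); first by rewrite subn1 prednK.
  split; last by move=> k; rewrite mxE; apply: pihomogP.
  rewrite /AR; apply: (mulIf g0); rewrite mul0r mulr_suml -[RHS]uf.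
  by apply: eq_bigr => k _; rewrite us mulrAC.
move=> s0; case/negP: u0; apply/eqP/rowP => k.
by rewrite us s0 !mxE mul0r.
Qed.

Lemma tangent_generators_contra (P : 'I_3 -> {poly C}) (f q : S) e D d1 d2 (u w r : 'rV[S]_3) :
  reduced_curve e f -> (d1 + d2 = e)%N ->
  AR_deg f d1 u -> AR_deg f d2 w -> AR_deg f d2 r -> u != 0 ->
  (forall x, AR f x -> exists a b c, x = a *: u + b *: w + c *: r) ->
  (forall t x, (t < d1)%N -> AR_deg f t x -> x = 0) ->
  q \is D.-homog -> mmap polyC P q = 0 -> mmap polyC P f != 0 ->
  (exists j, mmap polyC P q^`M(j) != 0) ->
  (forall g : S, g \is 1.-homog -> mmap polyC P g = 0 -> g = 0) ->
  mmap polyC P (\sum_j u 0 j * q^`M(j)) = 0 ->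
  mmap polyC P (\sum_j w 0 j * q^`M(j)) = 0 -> False.
Proof.
move=> red d12 uA wA rA u0 gen low hq qP fP [j qj] lin uq wq.
have [e0 hf f0 _] := red; have [uf hu] := uA; have [wf hw] := wA.
apply: (parallel_generators_contra red d12 uA wA rA u0 gen low) => k.
have [g [hg Dg ew]] := det3_syzygies red d12 hu hw uf wf.
have g0 : g = 0.
  apply: lin => //; apply/eqP.
  (* Along the curve all three pairings with the gradient of [q] vanish: those of [u] and [w] by
     hypothesis, that of the position vector by Euler's identity. *)
  have : mmap polyC P (det3 (u 0) (w 0) (fun j => 'X_j) * q^`M(j)) = 0.
    have /= -> := cramer3 (u 0) (w 0) (fun j => 'X_j) (fun i => q^`M(i)) j.
    have dotC (a b : 'I_3 -> S) : dot3 a b = \sum_j b j * a j.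
      by apply: eq_bigr => i _; rewrite mulrC.
    rewrite !dotC (euler_mderiv hq) !mmapD !rmorphM /=.
    by rewrite uq wq qP !mul0r mulr0 !mul0r !addr0.
  rewrite Dg !rmorphM /= => /eqP.
  by rewrite !mulf_eq0 (negPf fP) (negPf qj) orbF.
by apply: (mulfI (natr_mpoly_neq0 C e0)); rewrite ew g0 mul0r mulr0.
Qed.

End CrossHomog.

(** * Symmetric bilinear forms in dimension three *)

Section Bilinear.
Variable K : fieldType.
Implicit Types x y z : 'I_3 -> K.
Variables (M : 'I_3 -> 'I_3 -> K) (Msym : forall j k, M j k = M k j).

Definition apply_form x j := \sum_k M j k * x k.
Definition form x y := dot3 x (apply_form y).

Lemma dot3C x y : dot3 x y = dot3 y x.
Proof. by apply: eq_bigr => j _; rewrite mulrC. Qed.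

Lemma formE x y : form x y = \sum_j \sum_k x j * M j k * y k.
Proof.
by apply: eq_bigr => j _; rewrite mulr_sumr; apply: eq_bigr => k _; rewrite mulrA.
Qed.

Lemma formC x y : form x y = form y x.
Proof.
rewrite !formE exchange_big; apply: eq_bigr => j _; apply: eq_bigr => k _.
by rewrite (Msym j k); ring.
Qed.

Lemma form_lin a b x y z :
  form (fun j => a * x j + b * y j) z = a * form x z + b * form y z.
Proof.
rewrite /form /dot3 !mulr_sumr -big_split; apply: eq_bigr => j _ /=.
by rewrite mulrDl !mulrA.
Qed.

Lemma apply_form_ext x y : x =1 y -> apply_form x =1 apply_form y.
Proof. by move=> e j; apply: eq_bigr => k _; rewrite e. Qed.

Lemma form_ext x x' y y' : x =1 x' -> y =1 y' -> form x y = form x' y'.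
Proof. by move=> ex ey; apply: eq_bigr => j _; rewrite ex (apply_form_ext ey). Qed.

Lemma form_linr a b x y z :
  form z (fun j => a * x j + b * y j) = a * form z x + b * form z y.
Proof. by rewrite formC form_lin ![form z _]formC. Qed.

Lemma cross3_cross3 (u w x : 'I_3 -> K) j :
  cross3 (cross3 u w) x j = dot3 u x * w j - dot3 w x * u j.
Proof.
by rewrite /dot3 !sum3 /cross3; elim/ord3_ind: j; rewrite !ordS3; ring.
Qed.

Lemma dot3_cross3l (u w : 'I_3 -> K) : dot3 u (cross3 u w) = 0.
Proof. by rewrite /dot3 sum3 /cross3 !ordS3; ring. Qed.

Lemma dot3_cross3r (u w : 'I_3 -> K) : dot3 w (cross3 u w) = 0.
Proof. by rewrite /dot3 sum3 /cross3 !ordS3; ring. Qed.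

Lemma form_delta j x : form (fun k => (k == j)%:R) x = apply_form x j.
Proof.
by rewrite /form dot3C; apply: sum_delta.
Qed.

Hypotheses (two0 : (2%:R : K) != 0)
  (nondeg : forall x, (forall j, apply_form x j = 0) -> forall j, x j = 0).

Lemma hyperbolic_basis b : form b b = 0 -> (exists j, b j != 0) ->
  exists c d, [/\ form b c = 1, form c c = 0, form b d = 0, form c d = 0 &
    form d d != 0 /\
    forall x, exists be ga de, forall j, x j = be * b j + ga * c j + de * d j].
Proof.
move=> bb [j0 bj0].
have [j Abj] : exists j, apply_form b j != 0.
  apply: contrapT => /forallNP H; case/negP: bj0; apply/eqP; apply: nondeg => j.
  by have /negP := H j; rewrite negbK => /eqP.
pose c' k := (apply_form b j)^-1 * (k == j)%:R + 0 * b k.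
have c'b : form c' b = 1 by rewrite form_lin form_delta mul0r addr0 mulVf.
(* As [b] is isotropic and pairs to 1 with [c'], removing half of the square of [c'] times [b] makes
   the vector isotropic. *)
pose c k := 1 * c' k + (- (form c' c' / 2%:R)) * b k.
have bc : form b c = 1 by rewrite form_linr bb mulr0 addr0 mul1r formC.
have cc : form c c = 0.
  rewrite form_lin [form b c]bc mulr1 mul1r form_linr c'b mul1r mulr1.
  by field.
(* The vector product of the covectors of [b] and [c] spans the common orthogonal of [b] and [c]. *)
pose d := cross3 (apply_form b) (apply_form c).
have bd : form b d = 0 by rewrite formC /form dot3C dot3_cross3l.
have cd : form c d = 0 by rewrite formC /form dot3C dot3_cross3r.
have [i di] : exists i, d i != 0.
  apply: contrapT => /forallNP H; have d0 k : d k = 0.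
    by have /negP := H k; rewrite negbK => /eqP.
  have Ac k : apply_form c k = 0.
    have := cross3_cross3 (apply_form b) (apply_form c) c k.
    rewrite -/d [dot3 _ c]dot3C -/(form c b) formC bc [dot3 _ c]dot3C -/(form c c) cc.
    by rewrite mul1r mul0r subr0 /cross3 !d0 !mul0r subrr => <-.
  move: bc; rewrite /form /dot3 big1 => [/eqP|k _]; last by rewrite Ac mulr0.
  by rewrite eq_sym oner_eq0.
have orth x : form x b = 0 -> form x c = 0 -> forall k, x k = (x i / d i) * d k.
  move=> xb xc k; have x0 k' : cross3 x (fun k => (d i)^-1 * d k) k' = 0.
    have := cross3_cross3 (apply_form b) (apply_form c) x k'.
    rewrite -/d [dot3 _ x]dot3C -/(form x b) [dot3 _ x]dot3C -/(form x c) xb xc.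
    rewrite !mul0r subrr /cross3 => e; rewrite -[RHS](mulr0 (- (d i)^-1)) -[in RHS]e.
    ring.
  rewrite (cross3_eq0 x0 (i := i) (mulVf di)); ring.
have span x : exists be ga de, forall j, x j = be * b j + ga * c j + de * d j.
  pose y k := 1 * (1 * x k + (- form c x) * b k) + (- form b x) * c k.
  have yb : form y b = 0.
    rewrite (form_lin 1 (- form b x) (fun k => 1 * x k + (- form c x) * b k) c b).
    by rewrite (form_lin 1 _ x b b) bb (formC c b) bc (formC x b); ring.
  have yc : form y c = 0.
    rewrite (form_lin 1 (- form b x) (fun k => 1 * x k + (- form c x) * b k) c c).
    by rewrite (form_lin 1 _ x b c) cc bc (formC x c); ring.
  exists (form c x), (form b x), (y i / d i) => k.
  by rewrite -(orth y yb yc) /y; ring.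
exists c, d; split=> //; split=> //; apply: contraNneq di => dd.
apply/eqP; apply: nondeg => k; rewrite -form_delta.
have [be [ga [de xE]]] := span (fun k' => (k' == k)%:R).
rewrite (form_ext (x' := fun k => 1 * (be * b k + ga * c k) + de * d k) (y' := d)) //.
  rewrite (form_lin 1 de (fun k => be * b k + ga * c k) d d) (form_lin be ga b c d).
  by rewrite bd cd dd !mulr0 !addr0 mulr0.
by move=> k'; rewrite xE mul1r.
Qed.

End Bilinear.

Section Conic.
Variable C : numClosedFieldType.
Local Notation S := {mpoly C[3]}.

Variables (q : S) (smq : is_smooth_conic q).

Let M j k := (q^`M(j))@_U_(k).
Let hq : q \is 2.-homog. Proof. by case: smq. Qed.
Let hqj j : q^`M(j) \is 1.-homog. Proof. exact: (mderiv_dhomog j hq). Qed.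

Lemma hessian_sym j k : M j k = M k j.
Proof. by rewrite /M !mcoeffU_deriv mderiv_comm. Qed.

Lemma grad_conic x j : (q^`M(j)).@[x] = apply_form M x j.
Proof. by rewrite /meval (linear_mmap _ _ (hqj j)). Qed.

Lemma conic_form x : form M x x = 2%:R * q.@[x].
Proof.
have := congr1 (meval x) (euler_mderiv hq); rewrite raddf_sum rmorphM rmorph_nat /= => <-.
by apply: eq_bigr => j _; rewrite mevalM mevalXU grad_conic.
Qed.

(** At a nonzero vector of the radical all partial derivatives of [q] vanish, and [q] too by Euler's
    identity: it would be a singular point. *)
Lemma conic_nondeg x : (forall j, apply_form M x j = 0) -> forall j, x j = 0.
Proof.
move=> x0; apply: contrapT => /existsNP[j xj].
have r0 : \row_j x j != 0 :> 'rV[C]_3.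
  by apply/eqP => /rowP/(_ j); rewrite !mxE.
have rowE (F : S) : F.@[(\row_j x j : 'rV[C]_3) 0] = F.@[x].
  by apply: meval_eq => k; rewrite mxE.
case: smq => _ _ sing0; have : singular_points q (point r0); last by rewrite sing0.
have two0 : (2%:R : C) != 0 by rewrite pnatr_eq0.
split=> [|k].
  apply: (vanishes_at_point hq); rewrite rowE; apply: (mulfI two0).
  by rewrite -conic_form mulr0 /form /dot3 big1 // => k _; rewrite x0 mulr0.
by apply: (vanishes_at_point (hqj k)); rewrite rowE grad_conic x0.
Qed.

(** In a hyperbolic basis the curve c + d t + b t^2 has square (2 + form d d) t^2, so [d] is scaled
    to make [form d d] equal to -2. Pairing with [b] and [d] gives the functionals 1 and -2 t, and
    the curve lies on no line because [b], [c], [d] span. *)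
Lemma conic_param b : q.@[b] = 0 -> (exists j, b j != 0) ->
  exists P : 'I_3 -> {poly C}, [/\ curve_param P q 2, forall j, (P j)`_2 = b j &
    forall g : S, g \is 1.-homog -> mmap polyC P g = 0 -> g = 0].
Proof.
move=> qb b0; have two0 : (2%:R : C) != 0 by rewrite pnatr_eq0.
have bb : form M b b = 0 by rewrite conic_form qb mulr0.
have [c [d' [bc cc bd' cd' [dd' span']]]] :=
  hyperbolic_basis hessian_sym two0 conic_nondeg bb b0.
have [t0 tn0 tE] : exists2 t : C, t != 0 & t ^+ 2 * form M d' d' = - 2%:R.
  exists (sqrtC (- 2%:R / form M d' d')); last by rewrite sqrtCK divfK.
  by rewrite sqrtC_eq0 mulf_neq0 ?invr_eq0 // oppr_eq0.
have [d [dE bd cd dd]] : exists d : 'I_3 -> C, [/\ forall k, d k = t0 * d' k,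
    form M b d = 0, form M c d = 0 & form M d d = - 2%:R].
  exists (fun k => t0 * d' k + 0 * d' k); split.
  - by move=> k; rewrite mul0r addr0.
  - by rewrite (form_linr hessian_sym) bd' !mulr0 addr0.
  - by rewrite (form_linr hessian_sym) cd' !mulr0 addr0.
  rewrite -tE (form_lin M t0 0 d' d') (form_linr hessian_sym t0 0 d' d' d').
  by rewrite !mul0r !addr0 mulrA expr2.
have cb : form M c b = 1 by rewrite (formC hessian_sym).
have db : form M d b = 0 by rewrite (formC hessian_sym).
have dc : form M d c = 0 by rewrite (formC hessian_sym).
pose P j : {poly C} := (c j)%:P + d j *: 'X + b j *: 'X^2.
have fn (g : 'I_3 -> C) : \sum_j (g j)%:P * P j =
   (dot3 g c)%:P + dot3 g d *: 'X + dot3 g b *: 'X^2.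
  rewrite /dot3 !sum3 /P -!mul_polyC !polyCD !polyCM; ring.
have fnA x : \sum_j (apply_form M x j)%:P * P j =
   (form M c x)%:P + form M d x *: 'X + form M b x *: 'X^2.
  by rewrite fn ![dot3 (apply_form M x) _]dot3C.
have gradP j : mmap polyC P q^`M(j) =
    (apply_form M c j)%:P + apply_form M d j *: 'X + apply_form M b j *: 'X^2.
  by rewrite (linear_mmap _ _ (hqj j)) (fn (M j)).
have bP : \sum_j (apply_form M b j)%:P * P j = 1.
  by rewrite fnA cb db bb !scale0r !addr0.
have qP : mmap polyC P q = 0.
  have two0P : (2%:R : {poly C}) != 0 by rewrite -polyC_natr polyC_eq0.
  apply: (mulfI two0P); rewrite mulr0.
  have := congr1 (mmap polyC P) (euler_mderiv hq).
  rewrite raddf_sum rmorphM rmorph_nat /= => <-.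
  have -> : \sum_j mmap polyC P ('X_j * q^`M(j)) =
      \sum_j ((apply_form M c j)%:P * P j + ((apply_form M d j)%:P * P j) * 'X
        + ((apply_form M b j)%:P * P j) * 'X^2).
    apply: eq_bigr => j _; rewrite rmorphM /= mmapXU gradP -!mul_polyC.
    by move: (P j) (apply_form M c j) (apply_form M d j) (apply_form M b j) => p x y z; ring.
  rewrite !big_split /= -!mulr_suml bP !fnA cc cd bc dc dd bd !scale0r !addr0 add0r scale1r.
  by rewrite -mul_polyC polyCN polyC_natr ?add0r; ring.
exists P; split.
- apply: (@functional_param _ P q 2 (apply_form M b) (apply_form M d) (- 2%:R)) => //.
  + move=> z; apply: contrapT => /forallNP H.
    have /(congr1 (fun p : {poly C} => p.[z])) := bP; rewrite hornerC => /eqP.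
    have -> : (\sum_j (apply_form M b j)%:P * P j).[z] = form M b (fun j => (P j).[z]).
      rewrite horner_sum (formC hessian_sym) /form dot3C; apply: eq_bigr => j _.
      by rewrite hornerM hornerC.
    rewrite /form /dot3 big1 => [|j _]; first by rewrite eq_sym oner_eq0.
    by have /negP := H j; rewrite negbK grad_conic => /eqP ->; rewrite mulr0.
  + move=> j; rewrite /P -!mul_polyC; apply/leq_sizeP => k k3.
    rewrite !coefD coefC !coefCM coefX coefXn.
    by case: k k3 => [|[|[|k]]] //= _; rewrite !mulr0 !addr0.
  + by rewrite oppr_eq0.
  by rewrite fnA cd dd bd scale0r addr0 polyC0 add0r.
- by move=> j; rewrite /P !coefD coefC !coefZ coefX coefXn /= ?(mulr0, mulr1, add0r, addr0).
move=> g hg gP; pose ga j := g@_U_(j).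
have : \sum_j (ga j)%:P * P j = 0 by rewrite -[RHS]gP (linear_mmap _ _ hg).
rewrite fn => /polyP e.
have g0 : dot3 ga c = 0.
  by have := e 0%N; rewrite !coefD coefC !coefZ coefX coefXn coef0 /= ?(mulr0, mulr1, add0r, addr0).
have g1 : dot3 ga d = 0.
  by have := e 1%N; rewrite !coefD coefC !coefZ coefX coefXn coef0 /= ?(mulr0, mulr1, add0r, addr0).
have g2 : dot3 ga b = 0.
  by have := e 2%N; rewrite !coefD coefC !coefZ coefX coefXn coef0 /= ?(mulr0, mulr1, add0r, addr0).
have g1' : dot3 ga d' = 0.
  apply: (mulfI tn0); rewrite mulr0 -g1 /dot3 mulr_sumr; apply: eq_bigr => j _.
  by rewrite dE; ring.
rewrite (dhomog1_sum hg) big1 // => j _; rewrite -/(ga j).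
have [be [ka [de xE]]] := span' (fun k => (k == j)%:R).
have -> : ga j = be * dot3 ga b + ka * dot3 ga c + de * dot3 ga d'.
  rewrite -(sum_delta ga j) /dot3 !mulr_sumr -!big_split; apply: eq_bigr => k _ /=.
  by rewrite xE; ring.
by rewrite g0 g1' g2 !mulr0 !addr0 scale0r.
Qed.

(** On the line through the first two coordinate points [q] restricts to a polynomial whose leading
    coefficient is its value at the second; either this is zero or there is a root. *)
Lemma isotropic_vector : exists b, q.@[b] = 0 /\ exists j, b j != 0.
Proof.
have [q1|q1] := eqVneq (q.@[fun j : 'I_3 => (j == 1)%:R : C]) 0.
  by exists (fun j => (j == 1)%:R); split=> //; exists 1; rewrite eqxx oner_eq0.
pose P (j : 'I_3) : {poly C} := ((j == 0)%:R)%:P + (j == 1)%:R *: 'X.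
have szP j : (size (P j) <= 2)%N.
  rewrite /P; case: (j == 0); case: (j == 1);
    rewrite ?scale1r ?scale0r ?addr0 ?size_XaddC ?size_poly0 ?size_polyC ?leq_b1 //.
  - by rewrite addrC size_XaddC.
  - by rewrite (leq_trans (leq_b1 _)).
  by rewrite polyC0 add0r size_polyX.
have : (mmap polyC P q)`_(1 * 2) != 0.
  rewrite (coef_param szP hq) (meval_eq (v2 := fun j => (j == 1)%:R)) // => j.
  by rewrite /P coefD coefC coefZ coefX add0r mulr1.
move=> c2; have : size (mmap polyC P q) != 1%N.
  by apply: contraNneq c2 => sz; rewrite nth_default // sz.
case/closed_rootP => z qz; exists (fun j => (P j).[z]); split.
  by rewrite -meval_horner; apply/eqP.
by exists 0; rewrite /P eqxx hornerD hornerC hornerZ hornerX mul0r addr0 oner_eq0.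
Qed.

End Conic.

Section NearlyFreeConic.
Variable C : numClosedFieldType.
Local Notation S := {mpoly C[3]}.

Lemma dvd_const (p G R : {poly C}) : p != 0 -> R != 0 -> p %| G * R ->
  (size G + size R <= (size p).+1)%N -> exists k, G * R = k *: p.
Proof.
move=> p0 R0 /dvdpP[h GRE] sz; have [h0|h0] := eqVneq h 0.
  by exists 0; rewrite GRE h0 mul0r scale0r.
have G0 : G != 0.
  by apply: contraNneq (mulf_neq0 h0 p0) => G0; rewrite -GRE G0 mul0r.
suff /size_poly1P[k k0 hk] : size h == 1%N by exists k; rewrite GRE hk mul_polyC.
have := congr1 (fun r : {poly C} => size r) GRE; rewrite !size_mul //.
move: sz; have : (0 < size h)%N by rewrite size_poly_gt0.
have : (0 < size p)%N by rewrite size_poly_gt0.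
have : (0 < size G)%N by rewrite size_poly_gt0.
case: (size G) (size R) (size h) (size p) => [//|a] b [//|c] [//|d] _ _ _ /=.
by rewrite !addSn !addnS /=; lia.
Qed.

Lemma AR_deg_lin (f : S) d (u v : 'rV[S]_3) (a : C) :
  AR_deg f d u -> AR_deg f d v -> AR_deg f d (u - a%:MP *: v).
Proof.
case=> uf hu [vf hv]; split=> [|j]; last first.
  by rewrite !mxE mul_mpolyC; apply: rpredB => //; apply: rpredZ.
rewrite /AR; under eq_bigr => j _ do rewrite !mxE mulrBl -mulrA.
by rewrite sumrB -mulr_sumr uf vf mulr0 subr0.
Qed.

Lemma nearly_free_conic (f q : S) : nearly_free f -> is_smooth_conic q ->
  only_quasihomog_sing (f * q) ->
  `I_(2 * mdr f - 1)%N #<= curve_points f `&` curve_points q.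
Proof.
case=> e [d1 [d2 [d3 [v [red gens d12 d32]]]]] smq qh; subst d3.
have [hq q0 _] := smq; have [e0 hf f0 _] := red.
have [[b [qb b0 fb]]|/forallNP onq] := pselect (exists b : 'I_3 -> C,
    [/\ q.@[b] = 0, exists j, b j != 0 & f.@[b] != 0]); last first.
  have [b [qb b0]] := isotropic_vector smq.
  have [P [param _ _]] := conic_param smq qb b0.
  apply: (infinite_points _ param hq hf); have [qP _ _ _ _] := param.
  apply/eqP; apply/negPn/negP => fP; have [z fz] := closed_nonrootP _ fP.
  case: (onq (fun j => (P j).[z])); split; last by rewrite -meval_horner.
    by rewrite -meval_horner qP horner0.
  apply: contrapT => /forallNP Pz; case/negP: (param_row_neq0 param z).
  by apply/eqP/rowP => j; have /negP := Pz j; rewrite negbK !mxE => /eqP.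
have [P [param Pb lin]] := conic_param smq qb b0; have [qP qreg _ _ _] := param.
apply: contrapT => few.
have fPsz : size (mmap polyC P f) = (2 * e).+1.
  by apply: (size_mmap_param param hf); rewrite (meval_eq (v2 := b)).
have fP0 : mmap polyC P f != 0 by rewrite -size_poly_eq0 fPsz.
have [R [R0 szR dvd]] := few_points_dvd param hq hf red qh fP0 few.
have [srt hom gen min] := gens.
have md : (mdr f <= d1)%N.
  apply: (proj2 (mdrP hf)); exists (v 0); last exact: min_gens_neq0 gens.
  exact: hom.
have d12' : (d1 <= d2)%N by move: srt => /= /andP[].
have low t x : (t < d1)%N -> AR_deg f t x -> x = 0.
  move=> td; apply: (min_gens_low_degree gens) => i.
  by elim/ord3_ind: i; rewrite (tnth_nth 0%N) //=; apply: leq_trans d12'.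
have [v0A v1A v2A] : [/\ AR_deg f d1 (v 0), AR_deg f d2 (v 1) & AR_deg f d2 (v 2%:R)].
  by split; [have := hom 0 | have := hom 1 | have := hom 2%:R]; rewrite (tnth_nth 0%N).
pose G (w : 'rV[S]_3) := mmap polyC P (\sum_j w 0 j * q^`M(j)).
have szG d w : AR_deg f d w -> (size (G w) <= (2 * (d + 1)).+1)%N.
  case=> _ hw; apply: (size_param param); apply: rpred_sum => j _.
  by apply: dhomogM => //; apply: (mderiv_dhomog j hq).
have Glin (a : C) u w : G (u - a%:MP *: w) = G u - a *: G w.
  rewrite /G -mul_polyC -mmapZ -mmapB; congr mmap; rewrite scaler_sumr -sumrB.
  by apply: eq_bigr => j _; rewrite !mxE mulrBl -mulrA mul_mpolyC.
have R_gt0 : (0 < size R)%N by rewrite size_poly_gt0.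
(* The degrees of [G w] and [R] add up to at most 2(d + 1) + 2(d1 - 1), which does not exceed the
   degree 2e of [f(P)], so the quotient is constant. [R_gt0] excludes [mdr f = 0], where the
   subtraction would truncate. *)
have GR d w : (d <= d2)%N -> AR_deg f d w -> exists k, G w * R = k *: mmap polyC P f.
  move=> dd wA; apply: dvd_const fP0 R0 (dvd _ _ wA) _.
  rewrite fPsz; apply: leq_trans (leq_add (szG _ _ wA) szR) _; rewrite -d12.
  by move: R_gt0 szR md dd; clear; lia.
have [k0 E0] := GR _ _ d12' v0A.
have [k1 E1] := GR _ _ (leqnn _) v1A.
have [k2 E2] := GR _ _ (leqnn _) v2A.
have G0 w : G w * R = 0 -> G w = 0.
  by move/eqP; rewrite mulf_eq0 (negPf R0) orbF => /eqP.
have [j qj] := qreg 0.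
have qjP : exists j, mmap polyC P q^`M(j) != 0.
  by exists j; apply: contraNneq qj => e'; rewrite -meval_horner e' horner0.
have gen3 x : AR f x -> exists a b c, x = a *: v 0 + b *: v 1 + c *: v 2%:R.
  by move=> /gen[c ->]; exists (c 0), (c 1), (c 2%:R); rewrite sum3.
have [k00|k0n] := eqVneq k0 0.
  have G00 : G (v 0) = 0 by apply: G0; rewrite E0 k00 scale0r.
  have v0n := min_gens_neq0 0 gens.
  have [k10|k1n] := eqVneq k1 0.
    apply: (tangent_generators_contra red d12 v0A v1A v2A v0n gen3 low hq qP fP0 qjP lin G00).
    by apply: G0; rewrite E1 k10 scale0r.
  (* [v 1] and [v 2%:R] both have degree d2, so this combination is homogeneous, with scalars chosen
     to cancel; [v 1] becomes the third generator. *)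
  have wA := AR_deg_lin (k2 / k1) v2A v1A.
  apply: (tangent_generators_contra red d12 v0A wA v1A v0n _ low hq qP fP0 qjP lin G00).
    move=> x /gen3[a [b' [c ->]]]; exists a, c, (b' + c * (k2 / k1)%:MP).
    rewrite scalerBr scalerDl !scalerA -!addrA; congr (_ + _).
    by rewrite addrC; congr (_ + _); rewrite addrCA addNr addr0.
  apply: G0; rewrite Glin mulrBl -scalerAl E1 E2 scalerA divfK // subrr.
  by [].
(* For d1 < d2 the degree count for [v 0] is strict and would force [k0 = 0]. Equal degrees make it
   homogeneous to subtract multiples of [v 0] from the other two generators. *)
have d12e : d1 = d2.
  apply/eqP; rewrite eqn_leq d12' leqNgt; apply/negP => dlt; case/negP: k0n.
  have G00 : G (v 0) = 0.
    apply: (dvd_size_lt R0 (dvd _ _ v0A)); rewrite fPsz -/(G (v 0)).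
    apply: leq_trans (leq_add (szG _ _ v0A) szR) _; rewrite -d12.
    by move: R_gt0 szR md dlt; clear; lia.
  by move: E0; rewrite G00 mul0r => /esym/eqP; rewrite scaler_eq0 (negPf fP0) orbF.
have v0A' : AR_deg f d2 (v 0) by rewrite -d12e.
have uA := AR_deg_lin (k1 / k0) v1A v0A'; have wA := AR_deg_lin (k2 / k0) v2A v0A'.
(* Otherwise [v 1] would be a multiple of [v 0], against the minimality of the generators. *)
have u0 : v 1 - (k1 / k0)%:MP *: v 0 != 0.
  apply/eqP => /eqP; rewrite subr_eq0 => /eqP v1E; apply: (min 1) => x /gen3[a [b' [c ->]]].
  exists (fun i => if i == 0 then a + b' * (k1 / k0)%:MP else c).
  rewrite big_mkcond sum3 /= addr0 v1E scalerDl scalerA; congr (_ + _).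
rewrite -{1}d12e in uA.
apply: (tangent_generators_contra red d12 uA wA v0A' u0 _ low hq qP fP0 qjP lin).
- move=> x /gen3[a [b' [c ->]]]; exists b', c, (a + b' * (k1 / k0)%:MP + c * (k2 / k0)%:MP).
  rewrite !scalerBr !scalerDl !scalerA.
  move: (a *: v 0) (b' *: v 1) (c *: v 2%:R) ((b' * _) *: v 0) ((c * _) *: v 0) => y1 y2 y3 y4 y5.
  by rewrite [(y2 - y4) + (y3 - y5)]addrACA -opprD -[y1 + y4 + y5]addrA [RHS]addrCA subrK addrA.
- by apply: G0; rewrite Glin mulrBl -scalerAl E0 E1 scalerA divfK // subrr.
by apply: G0; rewrite Glin mulrBl -scalerAl E0 E2 scalerA divfK // subrr.
Qed.

End NearlyFreeConic.

Theorem corollary6p9 (R : realType) :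
  (forall f1 l : {mpoly R[i][3]},
     nearly_free f1 ->
     is_line l ->
     ~ component l f1 ->
     only_quasihomog_sing f1 ->
     only_quasihomog_sing (f1 * l) ->
     `I_(mdr f1) #<= curve_points f1 `&` curve_points l)
  /\
  (forall f1 q : {mpoly R[i][3]},
     nearly_free f1 ->
     is_smooth_conic q ->
     ~ component q f1 ->
     only_quasihomog_sing f1 ->
     only_quasihomog_sing (f1 * q) ->
     `I_(2 * mdr f1 - 1)%N #<= curve_points f1 `&` curve_points q).
Proof.
split=> f1 l nf hl _ _ qh; [exact: nearly_free_line | exact: nearly_free_conic].
Qed.
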